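(* Assume $A_\mu\le2$ and let $z_0\in B$. The following are equivalent: (a) some absolutely continuous curve in $U_B$ reaches the corner with finite length, i.e. has finite $g_\mu$-length and satisfies $x\to0$ and $y\to0$ along one end of its parameter interval; (b) the diagonal curve $r\mapsto(r,r,z_0)$ has finite $g_\mu$-length near $r=0$; (c) $\int^\infty\sqrt{\mathcal T_\mu(S)}\,dS<\infty$; (d) every sequence in $U_B$ converging Euclideanly to $(0,0,z_0)$ is $d_\mu$-Cauchy, and all such sequences define one and the same point of the metric completion of $(U_B,d_\mu)$.
   Context: Let $k\ge0$, let $V\subset\mathbb R^k$ be open, let $0<\varepsilon<1$, and let $U=[0,\varepsilon)^2\times V$ with coordinates $(x,y,z)$ (an adapted chart of a manifold with corners near the codimension-two corner stratum $\{x=y=0\}$), with $U^\circ=(0,\varepsilon)^2\times V$. Let $g_{\mathrm E}$ be the Euclidean metric and $g_0$ a smooth Riemannian metric on $U$ with $c_0g_{\mathrm E}\le g_0\le C_0g_{\mathrm E}$ for constants $0<c_0\le C_0<\infty$. Let $\mu$ be a finite nonzero positive Radon measure with compact support $E=\operatorname{supp}\mu\subset\mathbb R_{\ge0}^2$. Let $u:E\times U^\circ\to(0,\infty)$ be jointly measurable with $0<c_u\le u(\alpha;x,y,z)\le C_u<\infty$ for $\mu$-almost every $\alpha\in E$ and every $(x,y,z)\in U^\circ$, and assume that $F_\mu(x,y,z)=\int_E u(\alpha;x,y,z)x^{-\alpha_1}y^{-\alpha_2}\,d\mu(\alpha)$ is continuous and positive on $U^\circ$. Put $g_\mu=F_\mu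 g_0$. Fix a Euclidean ball $B$ relatively compact in $V$, and let $U_B=(0,\varepsilon)^2\times B$. Let $d_\mu$ be the intrinsic distance on $U_B$: the infimum of $g_\mu$-lengths of absolutely continuous curves contained in $U_B$. Put $A_\mu=\max_{\alpha\in E}(\alpha_1+\alpha_2)$ and $\mathcal T_\mu(S)=\int_E e^{-S(2-\alpha_1-\alpha_2)}\,d\mu(\alpha)$ for $S\ge0$. The notation $\int^\infty$ means the integral over $[S_0,\infty)$ for some (equivalently any) $S_0\ge0$. *)

(* Defs.v *)
From HB Require Import structures.
From mathcomp Require Import all_boot all_order all_algebra.
From mathcomp Require Import all_classical all_reals all_analysis.
Set Implicit Arguments.
Unset Strict Implicit.
Unset Printing Implicit Defensive.
Import Order.TTheory GRing.Theory Num.Theory.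
Import numFieldNormedType.Exports.
Local Open Scope classical_set_scope.
Local Open Scope ring_scope.

(* The norm of the library on 'rV[R]_n is the sup norm, so the Euclidean norm
   is spelled out; the two induce the same topology. *)
Definition enorm (R : realType) (n : nat) (v : 'rV[R]_n) : R :=
  Num.sqrt (\sum_(i < n) v 0 i ^+ 2).

Definition eball (R : realType) (n : nat) (c : 'rV[R]_n) (r : R) :
  set 'rV[R]_n := [set z | enorm (z - c) < r].

Definition relatively_compact_in (T : topologicalType) (B V : set T) : Prop :=
  compact (closure B) /\ closure B `<=` V.

(* C^m on an open set W, by recursion on m: f is continuous on W and, if
   m = m'.+1, every directional derivative exists on W and is C^m' there. *)
Fixpoint Cn_on (R : realType) (n m : nat) (W : set 'rV[R]_n)
    (f : 'rV[R]_n -> R) : Prop :=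
  (forall p, W p -> {for p, continuous f}) /\
  (if m is m'.+1 then
     forall v : 'rV[R]_n,
       (forall p, W p -> derivable f p v) /\ Cn_on m' W ('D_v f)
   else True).

(* Smoothness on a set that need not be open (here, one with corners): f has,
   near each point of U, a smooth extension to a full neighbourhood. *)
Definition smooth_on (R : realType) (n : nat) (U : set 'rV[R]_n)
    (f : 'rV[R]_n -> R) : Prop :=
  forall p, U p -> exists W : set 'rV[R]_n, exists h : 'rV[R]_n -> R,
    [/\ open W, W p, (forall m, Cn_on m W h) &
        forall q, W q -> U q -> h q = f q].

(* Value at p, on the vector v, of the quadratic form with matrix g p. *)
Definition metric_sq (R : realType) (n : nat) (g : 'rV[R]_n -> 'M[R]_n)
    (p v : 'rV[R]_n) : R := (v *m g p *m v^T) 0 0.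

Definition riemannian_metric (R : realType) (n : nat) (U : set 'rV[R]_n)
    (g : 'rV[R]_n -> 'M[R]_n) : Prop :=
  (forall i j, smooth_on U (fun p => g p i j)) /\
  (forall p, U p ->
     (g p)^T = g p /\ forall v, v != 0 -> 0 < metric_sq g p v).

Definition abs_continuous (R : realType) (n : nat) (a b : R)
    (gamma : R -> 'rV[R]_n) : Prop :=
  forall e : R, 0 < e -> exists2 d : R, 0 < d &
    forall (m : nat) (s t : 'I_m -> R),
      (forall i, a <= s i /\ s i <= t i /\ t i <= b) ->
      (forall i j, i != j -> `]s i, t i[ `&` `]s j, t j[ = set0) ->
      \sum_(i < m) (t i - s i) < d ->
      \sum_(i < m) enorm (gamma (t i) - gamma (s i)) < e.

(* On a parameter interval that need not be compact, absolute continuity is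
   required on each compact subinterval. *)
Definition ac_curve_in (R : realType) (n : nat) (X : set 'rV[R]_n)
    (J : interval R) (gamma : R -> 'rV[R]_n) : Prop :=
  (forall t, t \in J -> X (gamma t)) /\
  (forall a b, a \in J -> b \in J -> a <= b -> abs_continuous a b gamma).

(* The derivative of an absolutely continuous curve exists almost everywhere
   on J; the values of derive1 elsewhere do not affect the integral. *)
Definition curve_length (R : realType) (n : nat) (g : 'rV[R]_n -> 'M[R]_n)
    (J : interval R) (gamma : R -> 'rV[R]_n) : \bar R :=
  (\int[lebesgue_measure]_(t in [set` J])
     (Num.sqrt (metric_sq g (gamma t) (derive1 gamma t)))%:E)%E.

(* The filters of the two ends of an interval, which may be finite or
   infinite; at an end that belongs to J this is the principal filter. *)
Definition upper_end (R : realType) (J : interval R) : set_system R :=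
  filter_from [set` J] (fun t => [set s | s \in J /\ t <= s]).

Definition lower_end (R : realType) (J : interval R) : set_system R :=
  filter_from [set` J] (fun t => [set s | s \in J /\ s <= t]).

Definition intrinsic_dist (R : realType) (n : nat) (g : 'rV[R]_n -> 'M[R]_n)
    (X : set 'rV[R]_n) (p q : 'rV[R]_n) : \bar R :=
  ereal_inf [set l | exists a b (gamma : R -> 'rV[R]_n),
    [/\ a <= b, ac_curve_in X `[a, b] gamma, gamma a = p, gamma b = q &
        l = curve_length g `[a, b] gamma]].

Definition cauchy_seq (R : realType) (T : Type) (X : set T)
    (d : T -> T -> \bar R) (s : nat -> T) : Prop :=
  (forall i, X (s i)) /\
  (forall e : R, 0 < e -> exists N : nat, forall i j : nat,
     (N <= i)%N -> (N <= j)%N -> (d (s i) (s j) < e%:E)%E).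

(* Points of the metric completion of (X, d) are the classes of Cauchy
   sequences of X, s and t being identified when d (s i) (t i) tends to 0. *)
Definition completion_class (R : realType) (T : Type) (X : set T)
    (d : T -> T -> \bar R) (s : nat -> T) : set (nat -> T) :=
  [set t | cauchy_seq X d t /\ d (s i) (t i) @[i --> \oo] --> 0%E].

Definition metric_completion (R : realType) (T : Type) (X : set T)
    (d : T -> T -> \bar R) : set (set (nat -> T)) :=
  [set completion_class X d s | s in [set s | cauchy_seq X d s]].

Definition radon (R : realType)
    (mu : {measure set (R * R)%type -> \bar R}) : Prop :=
  (forall K : set (R * R)%type, compact K -> (mu K < +oo)%E) /\
  (forall A : set (R * R)%type, measurable A ->
     mu A = ereal_sup [set mu K | K in [set K | compact K /\ K `<=` A]]).

Definition msupp (R : realType)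
    (mu : {measure set (R * R)%type -> \bar R}) : set (R * R)%type :=
  [set a | forall W : set (R * R)%type, open W -> W a -> (0 < mu W)%E].

(* Points of R^(2 + k) are written (x, y, z) with z in R^k. *)
Definition pt (R : realType) (k : nat) (x y : R) (z : 'rV[R]_k) :
    'rV[R]_(2 + k) :=
  row_mx (\row_(i < 2) (if i == 0 then x else y)) z.

Definition xcoord (R : realType) (k : nat) (p : 'rV[R]_(2 + k)) : R :=
  lsubmx p 0 0.

Definition ycoord (R : realType) (k : nat) (p : 'rV[R]_(2 + k)) : R :=
  lsubmx p 0 1.

Definition zcoord (R : realType) (k : nat) (p : 'rV[R]_(2 + k)) : 'rV[R]_k :=
  rsubmx p.

Definition corner_chart (R : realType) (k : nat) (eps : R) (V : set 'rV[R]_k) :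
    set 'rV[R]_(2 + k) :=
  [set p | [/\ 0 <= xcoord p < eps, 0 <= ycoord p < eps & V (zcoord p)]].

Definition open_chart (R : realType) (k : nat) (eps : R) (V : set 'rV[R]_k) :
    set 'rV[R]_(2 + k) :=
  [set p | [/\ 0 < xcoord p < eps, 0 < ycoord p < eps & V (zcoord p)]].

(* Joint measurability for the Borel sigma-algebra of R^2 x R^(2 + k). *)
Definition jointly_measurable (R : realType) (k : nat)
    (E : set (R * R)%type) (X : set 'rV[R]_(2 + k))
    (u : R * R -> 'rV[R]_(2 + k) -> R) : Prop :=
  measurable_fun
    (E `*` X : set (g_sigma_algebraType
                      (@open ((R * R)%type * 'rV[R]_(2 + k))%type)))
    (fun q => u q.1 q.2).

Definition Fmu (R : realType) (k : nat)
    (mu : {measure set (R * R)%type -> \bar R})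
    (u : R * R -> 'rV[R]_(2 + k) -> R) (p : 'rV[R]_(2 + k)) : R :=
  \int[mu]_(a in msupp mu)
    (u a p * xcoord p `^ (- a.1) * ycoord p `^ (- a.2)).

Definition gmu (R : realType) (k : nat)
    (mu : {measure set (R * R)%type -> \bar R})
    (u : R * R -> 'rV[R]_(2 + k) -> R)
    (g0 : 'rV[R]_(2 + k) -> 'M[R]_(2 + k)) (p : 'rV[R]_(2 + k)) :
    'M[R]_(2 + k) := Fmu mu u p *: g0 p.

(* This supremum is a maximum when the support is compact and nonempty. *)
Definition Amu (R : realType)
    (mu : {measure set (R * R)%type -> \bar R}) : R :=
  sup [set a.1 + a.2 | a in msupp mu].

Definition Tmu (R : realType)
    (mu : {measure set (R * R)%type -> \bar R}) (S : R) : R :=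
  \int[mu]_(a in msupp mu) expR (- S * (2 - a.1 - a.2)).

(* Main.v *)
(* Everything is equivalent to the convergence of the dyadic series
   sum_n sqrt (T_mu n), which, T_mu being nonincreasing because A_mu <= 2, is
   the integral test for (c).

   Lower bound: since a.1, a.2 >= 0, for e^-(n+1) < x + y < e^-n one has
   x^-a.1 y^-a.2 >= (x + y)^-(a.1 + a.2) >= e^(2n) e^(-(n+1)(2 - a.1 - a.2)),
   hence F_mu >= cu e^(2n) T_mu (n+1). Along an absolutely continuous curve the
   sum x + y must vary by at least e^-n - e^-(n+1) inside this slice, which
   costs length at least a constant times sqrt (T_mu (n+1)). A curve reaching
   the corner, or curves joining the points of a Cauchy sequence tending to the
   corner, cross all the slices.

   Upper bound: symmetrically F_mu <= Cu e^(2n+2) T_mu n as soon as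
   min (x, y) >= m with e^-(n+1) <= m <= e^-n. Two points near the corner are
   joined by going straight from (x, y, z) to (M, M, z) with M = e^-N, then
   moving at level M, then going straight down; on the first and last segments
   an affine minorant of x and y runs through the slices at a speed comparable
   with that of the curve, so their lengths are bounded by the tail of the
   series. *)

(* The two bounds face different obstacles. [curve_length] integrates a pointwise derivative, while
   absolute continuity is an epsilon-delta condition, so the lower bound first needs x + y to be the
   integral of its derivative: by the Jordan decomposition it is a difference of two nondecreasing
   absolutely continuous functions, their Stieltjes measures have Lebesgue densities, and Lebesgue
   differentiation identifies density and derivative almost everywhere. The upper bound uses only
   affine paths, whose derivative is explicit, but a straight segment between two points near the
   corner may stay close to a face x = 0 or y = 0, where x + y does not control the metric from
   above; hence the detour through the diagonal, along which min (x, y) is controlled. The factor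
   e^(2n) in the bounds for F_mu becomes e^n in the speed and cancels the Euclidean width of slice
   n, which is why every slice costs a multiple of sqrt (T_mu n) with a constant free of n. *)
Require Import Defs.
From HB Require Import structures.
From mathcomp Require Import all_boot all_order all_algebra.
From mathcomp Require Import all_classical all_reals all_analysis.
From mathcomp Require Import measurable_realfun ring lra.
Set Implicit Arguments.
Unset Strict Implicit.
Unset Printing Implicit Defensive.
Import Order.TTheory GRing.Theory Num.Theory.
Import numFieldNormedType.Exports.
Local Open Scope classical_set_scope.
Local Open Scope ring_scope.

(* Neither the speed of a curve nor the integrand of F_mu at a fixed point is
   known to be measurable. The library integral of a nonnegative function is
   the supremum of the integrals of its simple minorants, a lower integral: it
   is monotone and subadditive over measurable covers without measurability. *)
Section lower_integral.
Context d (T : measurableType d) (R : realType).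
Variable mu : {measure set T -> \bar R}.
Local Open Scope ereal_scope.
Implicit Types (D : set T) (f g : T -> \bar R).
Import HBNNSimple.

Lemma ae_imply (P Q : T -> Prop) : (forall x, P x -> Q x) ->
  {ae mu, forall x, P x} -> {ae mu, forall x, Q x}.
Proof. by move=> PQ [N [mN N0 PN]]; exists N; split => // x nQ; apply: PN => /PQ. Qed.

Lemma ae_forall_ord n (P : 'I_n -> T -> Prop) :
  (forall i, {ae mu, forall x, P i x}) -> {ae mu, forall x, forall i, P i x}.
Proof.
move=> aeP; apply: (@ae_imply (fun x => forall m (i : 'I_n), i = m :> nat -> P i x)).
  by move=> x H i; exact: H.
apply: ae_foralln => m; have [mn|nm] := ltnP m n.
  apply: ae_imply (aeP (Ordinal mn)) => x Px i im.
  by rewrite (_ : i = Ordinal mn)//; exact: val_inj.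
by apply/aeW => x i im; have := ltn_ord i; rewrite im ltnNge nm.
Qed.

(** A simple minorant, extended by zero outside [D], is measurable on the whole space; the usual
    theory applies to it although [D] and [f] need not be measurable. *)
Lemma integral_ge0_minorants_le D f (X : \bar R) :
  (forall x, D x -> 0 <= f x) ->
  (forall g : T -> R, measurable_fun [set: T] g -> (forall x, 0 <= g x)%R ->
     (forall x, D x -> (g x)%:E <= f x) -> (forall x, ~ D x -> g x = 0%R) ->
     \int[mu]_x (g x)%:E <= X) ->
  \int[mu]_(x in D) f x <= X.
Proof.
move=> f0 H; rewrite ge0_integralE//=; apply: ge_ereal_sup => _ [h /= hf <-].
rewrite -integralT_nnsfun; apply: H.
- by [].
- by move=> x; exact: fun_ge0.
- by move=> x Dx; have := hf x; rewrite patchE mem_set.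
- move=> x nDx; have := hf x; rewrite patchE memNset// lee_fin => hx.
  by apply/eqP; rewrite eq_le hx/=.
Qed.

(** Domination is required only where [f] is positive, so that the same lemma also changes the
    domain. *)
Lemma integral_ge0_mono D D' f g :
  (forall x, D x -> 0 <= f x) -> (forall x, D' x -> 0 <= g x) ->
  (forall x, D x -> 0 < f x -> D' x /\ f x <= g x) ->
  \int[mu]_(x in D) f x <= \int[mu]_(x in D') g x.
Proof.
move=> f0 g0 fg; rewrite !ge0_integralE//=.
apply: ge_ereal_sup => _ [h /= hf <-].
apply: ereal_sup_ubound; exists h => //= x.
apply: (le_trans (hf x)); rewrite !patchE.
case: ifPn => [/set_mem Dx|_]; last by case: ifPn => // /set_mem; exact: g0.
have := f0 _ Dx; rewrite le_eqVlt => /predU1P[<-|f0x].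
  by case: ifPn => // /set_mem; exact: g0.
by have [D'x fgx] := fg _ Dx f0x; rewrite mem_set.
Qed.

(** The null set is removed from the minorant rather than from [f]: multiplied by c^-1 and by the
    indicator of the complement of [N], a minorant of [f] becomes one of [g]. *)
Lemma integral_ge0_ae_leZ D f g (c : R) : (0 < c)%R ->
  (forall x, D x -> 0 <= f x) -> (forall x, D x -> 0 <= g x) ->
  {ae mu, forall x, D x -> f x <= c%:E * g x} ->
  \int[mu]_(x in D) f x <= c%:E * \int[mu]_(x in D) g x.
Proof.
move=> c0 f0 g0 [N [mN N0 fgN]].
apply: integral_ge0_minorants_le => // h mh h0 hf hD.
pose k x := (c^-1 * (h x * \1_(~` N) x))%R.
have mk : measurable_fun [set: T] k.
  apply: measurable_funM => //; apply: measurable_funM => //.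
  by apply: measurable_indic; exact: measurableC.
have k0 x : (0 <= k x)%R.
  by rewrite /k; apply: mulr_ge0; [rewrite invr_ge0 ltW|exact: mulr_ge0].
have -> : \int[mu]_x (h x)%:E = c%:E * \int[mu]_x (k x)%:E.
  rewrite -ge0_integralZl//=; last 3 first.
    exact/measurable_EFinP.
    by move=> x _; rewrite lee_fin.
    by rewrite lee_fin ltW.
  apply: ae_eq_integral => //.
  - exact/measurable_EFinP.
  - by apply: measurable_funeM; exact/measurable_EFinP.
  - exists N; split => // x /= nx; apply: contrapT => Nx; apply: nx => _.
    rewrite -EFinM /k mulVKf ?gt_eqF// indicE mem_set//= mulr1//.
rewrite lee_pmul2l//.
apply: integral_ge0_mono => //.
- by move=> x _; rewrite lee_fin.
- move=> x _; rewrite lte_fin => kx.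
  have [Dx|nDx] := pselect (D x); last by rewrite /k hD// mul0r mulr0 ltxx in kx.
  split => //; have [Nx|Nx] := pselect (N x).
    by rewrite /k indicE memNset/= ?mulr0 ?ltxx// in kx *.
  have fgx : f x <= c%:E * g x.
    by apply: contrapT => nfg; apply: Nx; apply: fgN => /= /(_ Dx).
  rewrite /k indicE mem_set// mulr1.
  rewrite EFinM -(@lee_pmul2l _ c%:E)//.
  rewrite -!EFinM mulVKf ?gt_eqF//.
  exact: le_trans (hf _ Dx) fgx.
Qed.

Lemma integral_ge0_ae_le D f g :
  (forall x, D x -> 0 <= f x) -> (forall x, D x -> 0 <= g x) ->
  {ae mu, forall x, D x -> f x <= g x} ->
  \int[mu]_(x in D) f x <= \int[mu]_(x in D) g x.
Proof.
move=> f0 g0 fg; rewrite -[leRHS]mul1e; apply: integral_ge0_ae_leZ => //.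
by move: fg; apply: filterS => x fgx Dx; rewrite mul1e; exact: fgx.
Qed.

(** The integral of a measurable minorant splits over the disjointed cover, and each piece is a
    minorant of [f] on a part of [D]. *)
Lemma integral_ge0_cover D f (A : nat -> set T) :
  (forall n, measurable (A n)) -> D `<=` \bigcup_n A n ->
  (forall x, D x -> 0 <= f x) ->
  \int[mu]_(x in D) f x <= \sum_(n <oo) \int[mu]_(x in A n `&` D) f x.
Proof.
move=> mA DA f0; apply: integral_ge0_minorants_le => // h mh h0 hf hD.
have mh' B : measurable_fun B (fun x => (h x)%:E).
  by apply/measurable_EFinP; exact: measurable_funTS.
have h0' x : 0 <= (h x)%:E by rewrite lee_fin.
have -> : \int[mu]_x (h x)%:E = \int[mu]_(x in \bigcup_n A n) (h x)%:E.
  rewrite [RHS]integral_mkcond; apply: eq_integral => x _.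
  rewrite patchE; case: ifPn => // /negP nA; rewrite hD// => Dx.
  by apply: nA; rewrite inE; exact: DA.
rewrite seqDU_bigcup_eq ge0_integral_bigcup//; last exact: seqDU_measurable.
apply: lee_nneseries => n _.
  by move=> _; exact: integral_ge0.
apply: integral_ge0_mono => //; first by move=> x [_]; exact: f0.
move=> x nx; have Anx := subset_seqDU nx; rewrite lte_fin => hx.
have Dx : D x by apply: contrapT => nDx; rewrite hD// ltxx in hx.
by split => //; exact: hf.
Qed.

Lemma integral_ge0_cover2 D f (A B : set T) :
  measurable A -> measurable B -> D `<=` A `|` B ->
  (forall x, D x -> 0 <= f x) ->
  \int[mu]_(x in D) f x <=
    \int[mu]_(x in A `&` D) f x + \int[mu]_(x in B `&` D) f x.
Proof.
move=> mA mB DAB f0.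
apply: (le_trans (@integral_ge0_cover _ _ (bigcup2 A B) _ _ _)) => //.
- by move=> [|[|n]]; rewrite /bigcup2//=; exact: measurable0.
- by rewrite bigcup2E.
rewrite (nneseries_split 0 2)//=; last first.
  by move=> n _; apply: integral_ge0 => x [_]; exact: f0.
rewrite add0n big_ltn// big_nat1/= eseries0 ?adde0//.
by move=> [|[|n]]// _ _; rewrite /bigcup2/= set0I integral_set0.
Qed.

(** The [b n], extended by zero, add up to one measurable function; it lies below c f almost
    everywhere since at most one [A n] contains a given point. *)
Lemma integral_ge0_disjoint D f (K : nat) (A : nat -> set T)
    (b : nat -> T -> \bar R) (c : R) : (0 < c)%R ->
  (forall x, D x -> 0 <= f x) -> trivIset setT A ->
  (forall n, measurable (A n)) -> (forall n, A n `<=` D) ->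
  (forall n, measurable_fun (A n) (b n)) ->
  (forall n x, A n x -> 0 <= b n x) ->
  {ae mu, forall x, forall n, (n < K)%N -> A n x -> b n x <= c%:E * f x} ->
  \sum_(n < K) \int[mu]_(x in A n) b n x <= c%:E * \int[mu]_(x in D) f x.
Proof.
move=> c0 f0 tA mA AD mb b0 bf.
have b0' n x : 0 <= (b n \_ (A n)) x.
  by rewrite patchE; case: ifPn => // /set_mem; exact: b0.
have -> : \sum_(n < K) \int[mu]_(x in A n) b n x =
    \int[mu]_(x in D) \sum_(n < K) (b n \_ (A n)) x.
  rewrite [RHS]integral_mkcond.
  under [RHS]eq_integral => x _.
    have -> : ((fun y => \sum_(n < K) (b n \_ (A n)) y) \_ D) x =
              \sum_(n < K) (b n \_ (A n)) x.
      rewrite patchE; case: ifPn => // /negP nDx; rewrite big1// => i _.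
      by rewrite patchE ifN//; apply/negP => /set_mem /AD Dx; apply: nDx; rewrite inE.
    over.
  rewrite ge0_integral_sum//.
    by apply: eq_bigr => i _; rewrite [LHS]integral_mkcond.
  by move=> n; apply/(measurable_restrictT _ _).1.
apply: integral_ge0_ae_leZ => //.
  by move=> x _; exact: sume_ge0.
move: bf; apply: filterS => x bfx Dx.
have cf0 : 0 <= c%:E * f x by rewrite mule_ge0 ?f0// lee_fin ltW.
have [[n nK Anx]|nA] := pselect (exists2 n : nat, (n < K)%N & A n x); last first.
  rewrite big1// => i _; rewrite patchE ifN//; apply/negP => /set_mem Aix.
  by apply: nA; exists i.
rewrite (bigD1 (Ordinal nK))//= big1 => [|i /negP ni].
  by rewrite adde0 patchE mem_set//; exact: bfx.
rewrite patchE ifN//; apply/negP => /set_mem Aix; apply: ni.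
apply/eqP/val_inj => /=; apply: (tA _ _ I I); first by exists x.
Qed.

End lower_integral.

(** * Translation and the lower integral *)

Section translation.
Context (R : realType).
Notation mu := (@lebesgue_measure R).
Local Open Scope ereal_scope.

(** The image measure gives every half-open interval its length, which characterizes Lebesgue
    measure. *)
Lemma lebesgue_measure_translation (t : R) (A : set R) : measurable A ->
  lebesgue_measure ((fun x => x + t)%R @^-1` A) = lebesgue_measure A.
Proof.
move=> mA; pose phi := (fun x : measurableTypeR R => x + t)%R : measurableTypeR R -> measurableTypeR R.
have mphi : measurable_fun [set: measurableTypeR R] phi.
  by apply: measurable_funD.
pose m := pushforward mu phi.
pose m' := [the measure _ _ of m].
apply/esym; apply: (@lebesgue_measure_unique _ (m' mphi)) => //.
move=> _ [[a b] _ <-]; rewrite /m' /= /m /pushforward.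
have -> : phi @^-1` `]a, b]%classic = `](a - t)%R, (b - t)%R]%classic.
  by apply/seteqP; split => x /=; rewrite /phi !in_itv/= ltrBlDr lerBrDr.
rewrite !lebesgue_measure_itv/= !lte_fin ltrD2r; case: ifPn => // _.
by rewrite -!EFinD opprD addrACA opprK addNr addr0.
Qed.

Lemma integral_ge0_translation (t : R) (D : set R) (f : R -> \bar R) :
  (forall x, D x -> 0 <= f x) ->
  \int[mu]_(x in (fun x => x + t)%R @^-1` D) f (x + t)%R <= \int[mu]_(x in D) f x.
Proof.
move=> f0; apply: integral_ge0_minorants_le.
  by move=> x Dx; exact: f0.
move=> h mh h0 hf hD.
pose phi := (fun x : measurableTypeR R => x + t)%R : measurableTypeR R -> measurableTypeR R.
have mphi : measurable_fun [set: measurableTypeR R] phi.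
  by apply: measurable_funD.
pose k y := h (y - t)%R.
have mk : measurable_fun [set: R] k.
  by apply: measurableT_comp => //; exact: measurable_funB.
have -> : \int[mu]_x (h x)%:E = \int[mu]_y (k y)%:E.
  have /= := @ge0_integral_pushforward _ _ _ _ _ phi mphi mu setT (EFin \o k) measurableT.
  rewrite preimage_setT => H.
  transitivity (\int[mu]_x (EFin \o k \o phi) x).
    by apply: eq_integral => x _; rewrite /= /k /phi addrK.
  rewrite -H; last 2 first.
  - exact/measurable_EFinP.
  - by move=> y _; rewrite lee_fin; exact: h0.
  rewrite (@eq_measure_integral _ _ _ setT mu) => [//|A mA _].
  exact: lebesgue_measure_translation.
apply: integral_ge0_mono => //.
- by move=> x _; rewrite lee_fin; exact: h0.
- move=> x _; rewrite lte_fin => hx.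
  have Dx : D (x - t + t)%R.
    by apply: contrapT => nDx; rewrite /k hD// ltxx in hx.
  have := hf (x - t)%R Dx; rewrite subrK in Dx *.
  by split.
Qed.

End translation.

(** * Absolutely continuous real functions and their variation *)

Section real_ac.
Context (R : realType).
Implicit Types (a b : R) (f : R -> R) (p q : R * R) (L : seq (R * R)).

Definition subitv a b : pred (R * R) := fun p => [&& a <= p.1, p.1 <= p.2 & p.2 <= b].
Definition apart : rel (R * R) := fun p q => (p.2 <= q.1) || (q.2 <= p.1).

(* Lists instead of families indexed by ['I_m], so that one pair can be replaced
   by the consecutive pairs of a partition. *)
Definition ac_on a b f := forall e, 0 < e -> exists2 d, 0 < d &
  forall L, all (subitv a b) L -> pairwise apart L ->
    \sum_(p <- L) (p.2 - p.1) < d -> \sum_(p <- L) `|f p.2 - f p.1| < e.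

(** Serves with M = 1 for the coordinates of a curve and with M = 2 for x + y. *)
Lemma abs_continuous_ac_on n a b (g : R -> 'rV[R]_n) (f : R -> R) (M : R) : 0 < M ->
  (forall s t, `|f t - f s| <= M * enorm (g t - g s)) ->
  abs_continuous a b g -> ac_on a b f.
Proof.
move=> M0 fg acg e e0; have [d d0 dg] := acg (e / M) (divr_gt0 e0 M0); exists d => // L La LL Ld.
pose s (i : 'I_(size L)) := (nth (0, 0) L i).1.
pose t (i : 'I_(size L)) := (nth (0, 0) L i).2.
have sumE (F : R * R -> R) :
    \sum_(p <- L) F p = \sum_(i < size L) F (nth (0, 0) L i).
  by rewrite (big_nth (0, 0)) big_mkord.
apply: (@le_lt_trans _ _ (M * \sum_(i < size L) enorm (g (t i) - g (s i)))).
  by rewrite sumE mulr_sumr; apply: ler_sum => i _; exact: fg.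
rewrite -ltr_pdivlMl// mulrC; apply: dg.
- move=> i; have /(all_nthP (0, 0))/(_ i (ltn_ord i)) := La.
  by rewrite /subitv => /and3P[].
- move=> i j ij.
  have H (i' j' : 'I_(size L)) : (i' < j')%N ->
      `]s i', t i'[ `&` `]s j', t j'[ = set0.
    move=> ij'; have /(pairwiseP (0,0))/(_ i' j') := LL.
    rewrite !inE !ltn_ord => /(_ isT isT ij').
    rewrite /apart -/(s i') -/(t i') -/(s j') -/(t j') => H.
    apply/seteqP; split => // x []/=; rewrite !in_itv/=.
    by case/orP: H => H /andP[? ?] /andP[? ?]; lra.
  have [ij'|ij'|/val_inj ij'] := ltngtP i j.
  + exact: H.
  + by rewrite setIC; exact: H.
  + by rewrite ij' eqxx in ij.
- by move: Ld; rewrite sumE.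
Qed.

Fixpoint itv_pairs a (l : seq R) : seq (R * R) :=
  if l is x :: l' then (a, x) :: itv_pairs x l' else [::].

Lemma itv_pairsP a b l : itv_partition a b l ->
  [/\ all (subitv a b) (itv_pairs a l), pairwise apart (itv_pairs a l),
     \sum_(p <- itv_pairs a l) (p.2 - p.1) = b - a &
     forall f, \sum_(p <- itv_pairs a l) `|f p.2 - f p.1| = variation a b f l].
Proof.
elim: l a => [a /itv_partition_nil ->|x l ih a abl] /=.
  by split => //; [rewrite big_nil subrr|move=> f; rewrite big_nil variation_nil].
have ax : a < x by case: abl => /= /andP[].
have xbl := itv_partition_cons abl; have xb := itv_partition_le xbl.
have [h1 h2 h3 h4] := ih _ xbl.
have h1' : all (fun q => x <= q.1) (itv_pairs x l).
  by apply: sub_all h1 => q; rewrite /subitv => /and3P[].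
split.
- rewrite /subitv /= lexx (ltW ax) xb /=.
  by apply: sub_all h1 => q; rewrite /subitv => /and3P[? -> ->]; rewrite (le_trans (ltW ax)).
- by rewrite h2 andbT; apply: sub_all h1' => q xq; rewrite /apart/= xq.
- by rewrite big_cons h3/=; lra.
- by move=> f; rewrite big_cons h4 /variation/= [in RHS]big_nat_recl//=.
Qed.

(* [L2] is absorbed into [L1] one pair at a time, each pair being replaced by an
   arbitrary partition of it; the supremum over the partitions is then taken. *)
Lemma sum_total_variation_le a b f (e d : R) L1 L2 :
  (forall L, all (subitv a b) L -> pairwise apart L ->
    \sum_(p <- L) (p.2 - p.1) < d -> \sum_(p <- L) `|f p.2 - f p.1| < e) ->
  all (subitv a b) (L1 ++ L2) -> pairwise apart (L1 ++ L2) ->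
  \sum_(p <- L1 ++ L2) (p.2 - p.1) < d ->
  ((\sum_(p <- L1) `|f p.2 - f p.1|)%:E +
   \sum_(p <- L2) total_variation p.1 p.2 f <= e%:E)%E.
Proof.
move=> fe; elim: L2 L1 => [L1|[x y] L2 ih L1].
  by rewrite cats0 big_nil adde0 lee_fin => ? ? ?; exact/ltW/fe.
rewrite all_cat/= => /and3P[al1 xy al2].
rewrite pairwise_cat/= allrel_consr -andbA => /and5P[axy1 a12 p1 axy2 p2].
rewrite big_cat big_cons/= => Ld.
have axy1' : all (fun q => apart q (x, y)) L1 by [].
have subxy z w : subitv x y (z, w) -> subitv a b (z, w).
  by move: xy; rewrite /subitv/= => /and3P[? ? ?] /and3P[? ? ?]; apply/and3P; split; lra.
have apartxy z w q : subitv x y (z, w) -> apart q (x, y) -> apart q (z, w).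
  rewrite /apart /subitv/= => /and3P[? ? ?] /orP[h|h]; apply/orP.
    by left; lra.
  by right; lra.
have apartC q r : apart q r = apart r q by rewrite /apart orbC.
have key l : itv_partition x y l ->
   ((\sum_(p <- L1) `|f p.2 - f p.1|)%:E + ((variation x y f l)%:E +
   \sum_(p <- L2) total_variation p.1 p.2 f) <= e%:E)%E.
  move=> xyl; have [h1 h2 h3 h4] := itv_pairsP xyl.
  have h5 q : q \in itv_pairs x l -> subitv x y q by move/allP: h1; exact.
  rewrite addeA -EFinD -(h4 f) -big_cat/=; apply: ih.
  - rewrite !all_cat al1 al2 andbT/=; apply/allP => -[z w] /h5; exact: subxy.
  - rewrite -catA !pairwise_cat h2 p1 p2 !andbT/= allrel_catr a12 andbT/=.
    apply/andP; split.
      apply/allrelP => q [z w] qL1 /h5 zw.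
      by apply: apartxy zw _; move/allP: axy1'; exact.
    apply/allrelP => -[z w] q /h5 zw qL2.
    by rewrite apartC; apply: apartxy zw _; rewrite apartC; move/allP: axy2; exact.
  - by rewrite !big_cat/= h3; lra.
have xy' : x <= y by move: xy; rewrite /subitv/= => /and3P[].
set S1 := (\sum_(p <- L1) _)%:E in key *.
set S2 := (\sum_(p <- L2) _)%E in key *.
rewrite big_cons/= -/S2.
have S20 : (0 <= S2)%E.
  rewrite /S2 big_seq; apply: sume_ge0 => p pL2; apply: total_variation_ge0.
  by move/allP: al2 => /(_ _ pL2) /and3P[].
(* The supremum over partitions can cross the sum only once [S2] is finite, and a single partition
   shows this; for x = y it is the empty list. *)
have S2fin : S2 \is a fin_num.
  rewrite ge0_fin_numE//.
  have [xy0|xy0] := eqVneq x y.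
    have := key [::]; rewrite /itv_partition/= xy0 eqxx variation_nil add0e => /(_ _) h.
    apply: le_lt_trans (ltry e); apply: le_trans (h _) => //.
    by rewrite leeDr// lee_fin sumr_ge0.
  have xlty : x < y by rewrite lt_neqAle xy0.
  apply: le_lt_trans (ltry e); apply: le_trans (key _ (itv_partition1 xlty)).
  by rewrite addeA leeDr// -EFinD lee_fin addr_ge0// ?sumr_ge0.
rewrite -(fineK S2fin) in key *.
have key' : (total_variation x y f <= (e - (fine S1 + fine S2))%:E)%E.
  apply: ge_ereal_sup => _ [_ [l xyl <-] <-]; rewrite lee_fin.
  by have := key _ xyl; rewrite /S1 -!EFinD lee_fin/=; lra.
rewrite addeCA -EFinD.
apply: (le_trans (leeD2r _ key')); rewrite -EFinD lee_fin/=; lra.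
Qed.

Lemma ac_on_total_variation a b f : ac_on a b f -> forall e, 0 < e ->
  exists2 d, 0 < d & forall L, all (subitv a b) L -> pairwise apart L ->
    \sum_(p <- L) (p.2 - p.1) < d ->
    (\sum_(p <- L) total_variation p.1 p.2 f <= e%:E)%E.
Proof.
move=> acf e e0; have [d d0 fd] := acf e e0; exists d => // L La LL Ld.
have := @sum_total_variation_le a b f e d [::] L fd La LL Ld.
by rewrite big_nil add0e.
Qed.

(** The variation is at most 1 on an interval shorter than d, and steps of length d / 2 exhaust
    [a, x]. *)
Lemma ac_on_bounded_variation a b f : ac_on a b f ->
  forall x, a <= x <= b -> total_variation a x f \is a fin_num.
Proof.
move=> acf; have [d d0 fd] := ac_on_total_variation acf ltr01.
suff H n x : a <= x <= b -> x - a <= (d / 2) *+ n ->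
    total_variation a x f \is a fin_num.
  move=> x axb; apply: (H (Num.truncn ((x - a) / (d / 2))).+1) => //.
  rewrite -mulr_natl -ler_pdivrMr ?divr_gt0//.
  exact/ltW/truncnS_gt.
elim: n x => [|n ih] x /andP[ax xb].
  rewrite mulr0n => xa0; have -> : x = a by lra.
  by rewrite total_variationxx.
rewrite mulrS => xad.
pose y := Num.max a (x - d / 2).
have ay : a <= y by rewrite le_max lexx.
have yx : y <= x by rewrite ge_max ax/=; lra.
rewrite (total_variationD f ay yx) fin_numD ih; last 2 first.
- by rewrite ay/=; lra.
- rewrite lerBlDr ge_max; apply/andP; split; last lra.
  by rewrite lerDr mulrn_wge0//; lra.
rewrite ge0_fin_numE ?total_variation_ge0//=.
have := fd [:: (y, x)]; rewrite big_seq1/= big_seq1/= => h.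
apply: le_lt_trans (h _ _ _) (ltry _) => //.
- by rewrite /subitv/= andbT; apply/and3P.
- have : x - d / 2 <= y by rewrite le_max lexx orbT.
  lra.
Qed.

Lemma ac_onB a b f g : ac_on a b f -> ac_on a b g -> ac_on a b (f \- g).
Proof.
move=> acf acg e e0.
have [r r0 fr] := acf (e / 2) (divr_gt0 e0 (ltr0n _ 2)).
have [s s0 fs] := acg (e / 2) (divr_gt0 e0 (ltr0n _ 2)).
exists (Num.min r s); first by rewrite lt_min r0.
move=> L La LL; rewrite lt_min => /andP[Lr Ls].
apply: (@le_lt_trans _ _ (\sum_(p <- L) (`|f p.2 - f p.1| + `|g p.2 - g p.1|))).
  apply: ler_sum => p _ /=.
  rewrite [X in `|X|](_ : _ = (f p.2 - f p.1) - (g p.2 - g p.1)); last by ring.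
  by rewrite (le_trans (ler_normB _ _)).
by rewrite big_split/=; have := fr _ La LL Lr; have := fs _ La LL Ls; lra.
Qed.

(** Jordan decomposition, with [v] the total variation from [a]; its increments are the variations
    that [ac_on_total_variation] makes small. *)
Lemma ac_on_nondecreasing_decomp a b f : ac_on a b f ->
  exists2 v : R -> R, ac_on a b v &
    forall x y, a <= x -> x <= y -> y <= b -> v x <= v y /\ (v \- f) x <= (v \- f) y.
Proof.
move=> acf; have fin := ac_on_bounded_variation acf.
have TVE x y : a <= x -> x <= y -> y <= b ->
    (fine (total_variation a y f) - fine (total_variation a x f))%:E
    = total_variation x y f.
  move=> ax xy yb; rewrite EFinB !fineK ?fin// ?ax//; last 2 first.
  - by apply/andP; split; lra.
  - by apply/andP; split; lra.
  rewrite (total_variationD f ax xy) addeAC subee ?add0e// fin//.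
  by apply/andP; split; lra.
exists (fun x => fine (total_variation a x f)).
  move=> e e0; have [d d0 fd] := ac_on_total_variation acf (divr_gt0 e0 (ltr0n _ 2)).
  exists d => // L La LL Ld.
  apply: (@le_lt_trans _ _ (e / 2)); last lra.
  rewrite -lee_fin; apply: le_trans (fd L La LL Ld); rewrite -sumEFin.
  rewrite big_seq [leRHS]big_seq.
  apply: lee_sum => p /(allP La) /and3P[h1 h2 h3].
  have := total_variation_ge0 f h2; rewrite -(TVE _ _ h1 h2 h3) !lee_fin.
  by move=> H; rewrite ger0_norm.
move=> x y ax xy yb; have H := TVE x y ax xy yb.
have H0 := total_variation_ge0 f xy; have H1 := total_variation_ge f xy.
have H2 := ler_norm (f y - f x).
by move: H0 H1; rewrite -H !lee_fin => H0 H1; split => /=; lra.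
Qed.

(** Composition with [clamp a b] extends a function on [a, b] by its end values to the whole line,
    where continuity and Stieltjes measures are stated. *)
Definition clamp a b (x : R) := Num.max a (Num.min b x).

Lemma clamp_ge a b x : a <= clamp a b x.
Proof. by rewrite le_max lexx. Qed.

Lemma clamp_le a b x : a <= b -> clamp a b x <= b.
Proof. by move=> ab; rewrite ge_max ab/= ge_min lexx. Qed.

Lemma clamp_nd a b x y : x <= y -> clamp a b x <= clamp a b y.
Proof. by move=> xy; apply: le_max2 => //; apply: le_min2. Qed.

Lemma clamp_lip a b x y : x <= y -> clamp a b y - clamp a b x <= y - x.
Proof.
by move=> xy; rewrite /clamp /Num.max /Num.min; repeat case: ifPn; rewrite -?leNgt; lra.
Qed.

Lemma clampE a b x : a <= x <= b -> clamp a b x = x.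
Proof. by move=> /andP[ax xb]; rewrite /clamp (min_idPr xb) (max_idPr ax). Qed.

Lemma ac_on_clamp_continuous a b f : a <= b -> ac_on a b f ->
  continuous (f \o clamp a b).
Proof.
move=> ab acf x; apply/cvgrPdist_lt => e e0; have [d d0 fd] := acf e e0.
have key y z : y <= z -> z - y < d -> `|f (clamp a b z) - f (clamp a b y)| < e.
  move=> yz zyd; have := fd [:: (clamp a b y, clamp a b z)].
  rewrite !big_seq1/=; apply => //.
    by rewrite /subitv/= andbT clamp_ge clamp_le// clamp_nd.
  exact: le_lt_trans (clamp_lip a b yz) zyd.
exists d => //= y; rewrite /= => xyd.
have [xy|yx] := leP x y.
  by rewrite distrC; apply: key => //; move: xyd; rewrite distrC ger0_norm// subr_ge0.
by apply: key; [exact: ltW|move: xyd; rewrite gtr0_norm// subr_gt0].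
Qed.

End real_ac.

(** * Bounded open intervals of the line *)

Section open_intervals.
Context (R : realType).
Implicit Types (I J : set R).

(** The outer interval is half-open because a Stieltjes measure is evaluated on such intervals; the
    inner one bounds the Lebesgue measure from below. *)
Lemma open_interval_bounds I : open I -> is_interval I -> has_inf I -> has_sup I ->
  I `<=` `]inf I, sup I] /\ `]inf I, sup I[ `<=` I.
Proof.
move=> oI iI hi hs; split => x.
  move=> Ix; rewrite /= in_itv/= ub_le_sup ?andbT//; last by case: hs.
  rewrite lt_neqAle ge_inf ?andbT//; last by case: hi.
  apply/eqP => infx; have := oI; rewrite openE => /(_ _ Ix) [e /= e0 He].
  have Ixe : I (x - e / 2).
    apply: He => /=; rewrite opprB addrC subrK gtr0_norm; lra.
  by have := ge_inf hi.2 Ixe; rewrite infx; lra.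
rewrite /= in_itv/= => /andP[infx xsup].
have [y Iy yx] := inf_lt hi.1 infx.
have [z Iz xz] := sup_gt hs.1 xsup.
by apply: (iI _ _ Iy Iz); rewrite (ltW yx) (ltW xz).
Qed.

Lemma disjoint_intervals_le I J : is_interval I -> is_interval J ->
  has_inf I -> has_sup I -> has_inf J -> has_sup J ->
  I `&` J = set0 -> sup I <= inf J \/ sup J <= inf I.
Proof.
move=> iI iJ hiI hsI hiJ hsJ IJ0.
have IJ z : I z -> J z -> False by move=> Iz Jz; have : set0 z by rewrite -IJ0.
have key (A B : set R) x y : is_interval A -> is_interval B ->
    (forall z, A z -> B z -> False) -> has_sup A -> has_inf B ->
    A x -> B y -> x < y -> sup A <= inf B.
  move=> iA iB AB hsA hiB Ax By xy.
  apply: lb_le_inf; first exact: hiB.1.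
  move=> j Bj; apply: ge_sup; first exact: hsA.1.
  move=> i Ai; rewrite leNgt; apply/negP => ji.
  have [ix|xi] := leP i x; first by apply: (AB x) => //; apply: (iB j y) => //; apply/andP; split; lra.
  have [xj|jx] := leP x j; first by apply: (AB j) => //; apply: (iA x i) => //; apply/andP; split; lra.
  by apply: (AB x) => //; apply: (iB j y) => //; apply/andP; split; lra.
have [[x Ix] [y Jy]] := (hiI.1, hiJ.1).
have [xy|xy|xy] := ltgtP x y.
- by left; apply: key xy.
- by right; apply: key xy => // z Jz Iz; exact: IJ Iz Jz.
- by exfalso; apply: (IJ x); rewrite // xy.
Qed.

End open_intervals.

(** * Absolutely continuous functions as indefinite integrals *)

Section stieltjes.
Context (R : realType).
Notation lambda := (@lebesgue_measure R).

Lemma lebesgue_stieltjes_itv (f : cumulative R R) (x y : R) : x <= y ->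
  lebesgue_stieltjes_measure f `]x, y]%classic = (f y - f x)%:E.
Proof.
move=> xy; rewrite /lebesgue_stieltjes_measure /measure_extension.
by rewrite measurable_mu_extE/= ?wlength_itv_bnd//; exact: is_ocitv.
Qed.

(* The Lebesgue-Stieltjes measure of v is dominated by the Lebesgue measure: a
   null set lies in an open set of small measure, whose component intervals
   form an admissible family for the absolute continuity of v. The density is
   the Radon-Nikodym derivative. *)
Lemma ac_on_nondecreasing_density (a b : R) (v : R -> R) : a <= b -> ac_on a b v ->
  (forall x y, a <= x -> x <= y -> y <= b -> v x <= v y) ->
  exists2 rho : R -> R, lambda.-integrable setT (EFin \o rho) &
    forall x y, a <= x -> x <= y -> y <= b ->
      (\int[lambda]_(t in `]x, y]) (rho t)%:E = (v y - v x)%:E)%E.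
Proof.
move=> ab acv vnd; pose cl := clamp a b.
have cl_ge x : a <= cl x by exact: clamp_ge.
have cl_le x : cl x <= b by exact: clamp_le.
have cl_nd x y : x <= y -> cl x <= cl y by exact: clamp_nd.
pose w x := v (cl x).
have w_nd : nondecreasing w by move=> x y xy; apply: vnd => //; exact: cl_nd.
have w_cont : continuous w by exact: ac_on_clamp_continuous.
have w_rc : right_continuous w by exact: right_continuousW.
pose wc : cumulative R R := HB.pack w (isCumulative.Build R _ R w w_nd w_rc).
pose nu : {measure set (measurableTypeR R) -> \bar R} := lebesgue_stieltjes_measure wc.
have nuE x y : x <= y -> nu `]x, y]%classic = (w y - w x)%:E.
  exact: lebesgue_stieltjes_itv.
have mab : measurable (`]a, b]%classic : set (measurableTypeR R)).
  exact: measurable_itv.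
have nuab : (nu `]a, b]%classic < +oo)%E by rewrite nuE// ltry.
(* Restriction to ]a, b] makes the measure finite for Radon-Nikodym; every ]x, y] of the conclusion
   lies inside. *)
pose nur := mfrestr mab nuab.
have dom : nur `<< lambda.
  apply/null_content_dominatesP => A mA A0; apply/eqP.
  rewrite eq_le measure_ge0 andbT; apply/lee_addgt0Pr => e e0; rewrite add0e.
  have [d d0 vd] := acv e e0.
  have [W [oW AW Od]] := @lebesgue_regularity_outer R A d mA (eq_ind_r (fun z => z < +oo)%E (ltry 0) A0) d0.
  (* Boundedness gives every nonempty component an infimum and a supremum; the margin 1 keeps ]a, b]
     inside. *)
  pose W1 := W `&` `](a - 1), (b + 1)[%classic.
  have oW1 : open W1 by apply: openI => //; exact: itv_open.
  have W1d : (lambda W1 < d%:E)%E.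
    apply: le_lt_trans Od.
    apply: (@le_trans _ _ (lambda W)).
      by apply: le_measure; rewrite ?inE//; [exact: open_measurable|exact: open_measurable|exact: subIsetl].
    have mW : measurable (W : set (measurableTypeR R)) by exact: open_measurable.
    apply: (@le_trans _ _ (lambda ((W `\` A) `|` A))).
      apply: le_measure; rewrite ?inE//; first by apply: measurableU => //; exact: measurableD.
      by move=> x Wx; have [Ax|nAx] := pselect (A x); [right|left].
    apply: (le_trans (measureU2 _ _ _)) => //; first exact: measurableD.
    by rewrite [X in (_ + X)%E](A0 : lambda A = 0%E) adde0.
  pose J := open_disjoint_itv oW1.
  have oI n : open (J n) by exact: open_disjoint_itv_open.
  have iI n : is_interval (J n) by exact: open_disjoint_itv_is_interval.
  have tI : trivIset setT J by exact: open_disjoint_itv_trivIset.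
  have IE : W1 = \bigcup_n J n by exact: open_disjoint_itv_bigcup.
  have mI n : measurable (J n : set (measurableTypeR R)) by exact: open_measurable.
  have Iab n x : J n x -> a - 1 <= x <= b + 1.
    move=> Ix; have : W1 x by rewrite IE; exists n.
    by case=> _ /=; rewrite in_itv/= => /andP[/ltW -> /ltW ->].
  have lbI n : has_lbound (J n) by exists (a - 1) => x /Iab /andP[].
  have ubI n : has_ubound (J n) by exists (b + 1) => x /Iab /andP[].
  (* End points are clamped into [a, b], where [acv] applies; empty components, whose [inf] and
     [sup] are default values, become degenerate pairs. *)
  pose p n := if pselect (J n = set0) then (a, a) else (cl (inf (J n)), cl (sup (J n))).
  have p0 n : J n = set0 -> p n = (a, a) by rewrite /p; case: pselect.
  have p1 n : J n <> set0 -> p n = (cl (inf (J n)), cl (sup (J n))).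
    by rewrite /p; case: pselect.
  have hI n : J n <> set0 -> has_inf (J n) /\ has_sup (J n).
    by move=> /eqP/set0P In0; split; split.
  have infsup n : J n <> set0 -> inf (J n) <= sup (J n).
    move=> In0; have [[[x Ix] _] _] := hI n In0.
    by rewrite (le_trans (ge_inf (lbI n) Ix))// ub_le_sup.
  have p_sub n : subitv a b (p n).
    have [J0|In0] := pselect (J n = set0); [rewrite p0//|rewrite p1//]; rewrite /subitv/= ?lexx ?ab//.
    by rewrite cl_ge cl_le cl_nd// infsup.
  have p_len n : (((p n).2 - (p n).1)%:E <= lambda (J n))%E.
    have [J0|In0] := pselect (J n = set0); [rewrite p0// J0|rewrite p1//]; first by rewrite measure0/= subrr.
    have [hi hs] := hI n In0.
    have [_ sI] := open_interval_bounds (oI n) (iI n) hi hs.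
    apply: (@le_trans _ _ (lambda `]inf (J n), sup (J n)[%classic)).
      rewrite lebesgue_measure_itv/= lte_fin; case: ifPn => [_|].
        by rewrite -EFinD lee_fin clamp_lip// infsup.
      rewrite -leNgt => h; rewrite (_ : sup (J n) = inf (J n)) ?subrr//.
      by apply/eqP; rewrite eq_le h infsup.
    by apply: le_measure; rewrite ?inE.
  have p_nu n : (nu (J n) <= (`|v (p n).2 - v (p n).1|)%:E)%E.
    have [J0|In0] := pselect (J n = set0); [rewrite p0// J0|rewrite p1//]; first by rewrite measure0/= lee_fin.
    have [hi hs] := hI n In0.
    have [sI _] := open_interval_bounds (oI n) (iI n) hi hs.
    apply: (@le_trans _ _ (nu `]inf (J n), sup (J n)]%classic)).
      by apply: le_measure; rewrite ?inE//; exact: measurable_itv.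
    by rewrite nuE ?infsup// lee_fin ler_norm.
  have p_apart n m : n != m -> apart (p n) (p m).
    move=> nm; rewrite /apart; have [J0|In0] := pselect (J n = set0);
      have [Jm0|Im0] := pselect (J m = set0); rewrite ?(p0 _ J0) ?(p0 _ Jm0) ?(p1 _ In0) ?(p1 _ Im0) /=;
      rewrite ?lexx ?cl_ge ?orbT//.
    have [hin hsn] := hI n In0; have [him hsm] := hI m Im0.
    have Inm : J n `&` J m = set0.
      rewrite -subset0 => x [Inx Imx]; exfalso.
      by move/eqP: nm; apply; apply: tI => //; exists x.
    have [h|h] := disjoint_intervals_le (iI n) (iI m) hin hsn him hsm Inm.
      by rewrite cl_nd.
    by rewrite (cl_nd _ _ h) orbT.
  (* Absolute continuity speaks of finite families, so the bound is proved for partial sums and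
     passed to the limit. *)
  have nuW1 : (nu W1 <= e%:E)%E.
    rewrite IE measure_bigcup//.
    apply: lime_le; first by apply: is_cvg_nneseries => n _ _; exact: measure_ge0.
    near=> n.
    apply: (@le_trans _ _ (\sum_(0 <= i < n) (`|v (p i).2 - v (p i).1|)%:E)%E).
      rewrite (eq_bigl xpredT) => [|i]; last by rewrite in_setT.
      by apply: lee_sum => i _; exact: p_nu.
    rewrite (sumEFin _ xpredT) lee_fin -(big_map p xpredT (fun q => `|v q.2 - v q.1|)).
    apply/ltW/vd.
    - by apply/allP => _ /mapP[i _ ->].
    - rewrite pairwise_map; apply: (@sub_pairwise _ ltn); last first.
        by rewrite -sorted_pairwise ?iota_ltn_sorted//; exact: ltn_trans.
      by move=> i j /= ij; apply: p_apart; rewrite ltn_eqF.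
    - rewrite -lte_fin big_map -sumEFin; apply: le_lt_trans W1d.
      apply: (@le_trans _ _ (\sum_(0 <= i < n) lambda (J i))%E).
        by apply: lee_sum => i _; exact: p_len.
      rewrite IE measure_bigcup//.
      apply: le_trans (nneseries_lim_ge n _) => //.
      by rewrite [leRHS](eq_bigl xpredT) => [//|i]; rewrite in_setT.
  apply: le_trans nuW1; rewrite /nur /mfrestr /mrestr.
  apply: le_measure; rewrite ?inE.
  + exact: measurableI.
  + exact: open_measurable.
  + move=> x [Ax]; rewrite /= in_itv/= => /andP[ax xb]; split; first exact: AW.
    by rewrite /= in_itv/=; apply/andP; split; lra.
have [f [f0 ffin fint fE]] := radon_nikodym_sigma_finite dom.
exists (fine \o f).
  by apply: eq_integrable fint => // x _; rewrite /= fineK.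
move=> x y ax xy yb.
under eq_integral do rewrite fineK//.
rewrite -fE; last exact: measurable_itv.
rewrite /nur /= /mfrestr /mrestr setIidl; last first.
  by move=> z; rewrite /= !in_itv/= => /andP[? ?]; apply/andP; split; lra.
rewrite [LHS](nuE x y xy) /w /cl !clampE//; apply/andP; split; lra.
Unshelve. all: by end_near. Qed.

End stieltjes.

Section density.
Context (R : realType).
Notation lambda := (@lebesgue_measure R).

Definition density (a b : R) (f rho : R -> R) :=
  lambda.-integrable setT (EFin \o rho) /\
  forall x y, a <= x -> x <= y -> y <= b ->
    (\int[lambda]_(t in `]x, y]) (rho t)%:E = (f y - f x)%:E)%E.

Lemma ac_on_density (a b : R) (f : R -> R) : a <= b -> ac_on a b f ->
  exists rho, density a b f rho.
Proof.
move=> ab acf; have [v acv vf] := ac_on_nondecreasing_decomp acf.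
have [r1 i1 h1] := ac_on_nondecreasing_density ab acv (fun x y ax xy yb => (vf x y ax xy yb).1).
have [r2 i2 h2] := ac_on_nondecreasing_density ab (ac_onB acv acf)
  (fun x y ax xy yb => (vf x y ax xy yb).2).
exists (r1 \- r2); split.
  have -> : EFin \o (r1 \- r2) = ((EFin \o r1) \- (EFin \o r2))%E.
    by apply/funext => x /=; rewrite EFinB.
  exact: integrableB.
move=> x y ax xy yb.
under eq_integral do rewrite /= EFinB.
have mxy : measurable (`]x, y]%classic : set (measurableTypeR R)) by exact: measurable_itv.
rewrite (integralB mxy (integrableS measurableT mxy (@subsetT _ _) i1)
  (integrableS measurableT mxy (@subsetT _ _) i2)).
by rewrite h1// h2// -EFinB/=; congr (_%:E); lra.
Qed.

(** This ties the density to [derive1], which occurs in [curve_length]: near an interior point [f]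
    is a constant plus the indefinite integral of [rho]. *)
Lemma density_derivable (a b : R) (f rho : R -> R) : density a b f rho ->
  {ae lambda, forall t, a < t < b -> derivable f t 1 /\ derive1 f t = rho t}.
Proof.
move=> [irho rhoE].
have loc : locally_integrable setT rho by exact: open_integrable_locally openT irho.
have intr y : lambda.-integrable [set` Interval (BRight a) (BRight y)] (EFin \o rho).
  by apply: integrableS irho => //; exact: measurable_itv.
have := FTC1 intr loc => /=; set F := fun x => Rintegral _ _ _.
apply: filterS; first exact: (ae_filter_ringOfSetsType lambda).
move=> t /= H /andP[at' tb].
have [dF FE] := H at'.
have nearE : \forall x \near t, f x = (f a + F x).
  have : t \in `]a, b[ by rewrite in_itv/= at' tb.
  move=> /near_in_itvoo; apply: filterS => x; rewrite in_itv/= => /andP[/ltW ax /ltW xb].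
  by rewrite /F /Rintegral rhoE//=; lra.
have dF' : derivable (fun x => f a + F x) t 1.
  by apply: derivableD => //; exact: derivable_cst.
split.
  by apply: near_eq_derivable dF'; apply: filterS nearE => x /= ->.
rewrite derive1E (near_eq_derive _ nearE)//.
rewrite deriveD// derive_cst add0r -derive1E//.
Qed.

End density.

(** * Crossing one slice, then all of them *)

Section crossing.
Context (R : realType).
Notation lambda := (@lebesgue_measure R).

(* y is the first time at level l, x the last time before y at level m. *)
Let decreasing_crossing (a b l m : R) (w : R -> R) : a <= b -> l < m -> continuous w ->
  m <= w a -> w b <= l ->
  exists x y, [/\ a <= x, x < y, y <= b, m - l <= `|w y - w x| &
    forall t, x < t < y -> l < w t < m].
Proof.
move=> ab lm wc ma bl.
pose S1 := [set t | a <= t <= b /\ w t <= l].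
have S1i : has_inf S1.
  by split; [exists b; split => //; rewrite ab lexx|exists a => t [/andP[]]].
pose y := inf S1.
have yb : y <= b by apply: ge_inf; [exact: S1i.2|split => //; rewrite ab lexx].
have ay : a <= y by apply: lb_le_inf; [exact: S1i.1|move=> t [/andP[]]].
have nb x e : 0 < e -> exists2 d, 0 < d & forall t, `|x - t| < d -> `|w x - w t| < e.
  by move=> e0; have /cvgrPdist_lt/(_ _ e0)[d /= d0 wd] := wc x; exists d.
have wy : w y <= l.
  rewrite leNgt; apply/negP => lwy.
  have [d d0 wd] : exists2 d, 0 < d & forall t, `|y - t| < d -> `|w y - w t| < w y - l.
    by apply: nb; rewrite subr_gt0.
  have [t [tab tl] ty] := inf_adherent d0 S1i.
  have yt : y <= t by apply: ge_inf; [exact: S1i.2|].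
  have := wd t; rewrite ler0_norm ?subr_le0// => /(_ _).
  by have := ler_norm (w y - w t); rewrite /y; lra.
have yl t : a <= t -> t < y -> l < w t.
  move=> at' ty; rewrite ltNge; apply/negP => wtl.
  suff : y <= t by lra.
  by apply: ge_inf; [exact: S1i.2|split => //; apply/andP; split; lra].
pose S2 := [set t | a <= t <= y /\ m <= w t].
have S2s : has_sup S2.
  by split; [exists a; split => //; rewrite ay lexx|exists y => t [/andP[]]].
pose x := sup S2.
have ax : a <= x by apply: ub_le_sup; [exact: S2s.2|split => //; rewrite ay lexx].
have xy : x <= y by apply: ge_sup; [exact: S2s.1|move=> t [/andP[]]].
have wx : m <= w x.
  rewrite leNgt; apply/negP => wxm.
  have [d d0 wd] : exists2 d, 0 < d & forall t, `|x - t| < d -> `|w x - w t| < m - w x.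
    by apply: nb; rewrite subr_gt0.
  have [t [tab tm] tx] := sup_adherent d0 S2s.
  have xt : t <= x by apply: ub_le_sup; [exact: S2s.2|].
  have := wd t; rewrite ger0_norm ?subr_ge0// => /(_ _).
  by have := ler_norm (- (w x - w t)); rewrite normrN /x; lra.
have xm t : x < t -> t <= y -> w t < m.
  move=> xt ty; rewrite ltNge; apply/negP => wtm.
  suff : t <= x by lra.
  by apply: ub_le_sup; [exact: S2s.2|split => //; apply/andP; split; lra].
exists x, y; split => //.
- by rewrite lt_neqAle xy andbT; apply/eqP => xyE; move: wx wy; rewrite xyE; lra.
- by rewrite distrC ger0_norm; lra.
- move=> t /andP[xt ty]; rewrite yl//= ?xm// ?ltW//.
  lra.
Qed.

Lemma continuous_crossing (a b l m : R) (w : R -> R) : a <= b -> l < m -> continuous w ->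
  (m <= w a /\ w b <= l) \/ (w a <= l /\ m <= w b) ->
  exists x y, [/\ a <= x, x < y, y <= b, m - l <= `|w y - w x| &
    forall t, x < t < y -> l < w t < m].
Proof.
move=> ab lm wc [[]|[al mb]]; first exact: decreasing_crossing.
have wNc : continuous (\- w) by move=> t; exact/continuousN/wc.
have [x [y [ax xy yb h1 h2]]] : exists x y, [/\ a <= x, x < y, y <= b,
    - l - - m <= `|- w y - - w x| & forall t, x < t < y -> - m < - w t < - l].
  by apply: (decreasing_crossing ab _ wNc); rewrite ?ltrN2 ?lerN2.
exists x, y; split => //.
- rewrite (_ : w y - w x = - (- w y - - w x)); last ring.
  by rewrite normrN (le_trans _ h1)//; lra.
- by move=> t /h2; rewrite !ltrN2 andbC.
Qed.

(** The increment of [s] between two crossing times is the integral of [rho] over times that lie in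
    the slice. Composing with [clamp a b] makes this set of times open, hence measurable. *)
Lemma density_crossing (a b l m : R) (s rho : R -> R) : a <= b -> l < m ->
  ac_on a b s -> density a b s rho ->
  (m <= s a /\ s b <= l) \/ (s a <= l /\ m <= s b) ->
  ((m - l)%:E <= \int[lambda]_(t in `]a, b[ `&` (s \o clamp a b) @^-1` `]l, m[)
                  `|rho t|%:E)%E.
Proof.
move=> ab lm acs [irho srho] sab.
have cE t : a <= t -> t <= b -> (s \o clamp a b) t = s t.
  by move=> at' tb; rewrite /= clampE// at'.
have [x [y [ax xy yb h1 h2]]] : exists x y, [/\ a <= x, x < y, y <= b,
    m - l <= `|(s \o clamp a b) y - (s \o clamp a b) x| &
    forall t, x < t < y -> l < (s \o clamp a b) t < m].
  by apply: continuous_crossing => //; [exact: ac_on_clamp_continuous|rewrite !cE].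
rewrite !cE in h1; [|lra..].
have mxy : measurable (`]x, y]%classic : set (measurableTypeR R)) by exact: measurable_itv.
have mrho B : measurable_fun B (EFin \o rho).
  by apply: measurable_funTS; case/integrableP : irho.
apply: (@le_trans _ _ `|\int[lambda]_(t in `]x, y]) (rho t)%:E|%E).
  by rewrite srho ?(ltW xy)//= lee_fin.
apply: (le_trans (le_abse_integral _ mxy (mrho _))).
rewrite -integral_itv_bndo_bndc; last exact: measurableT_comp.
apply: integral_ge0_mono => // t; rewrite /= in_itv/= => /andP[xt ty] _; split => //.
split; first by rewrite in_itv/=; apply/andP; split; lra.
by rewrite in_itv/=; apply: h2; rewrite xt.
Qed.

End crossing.

Section dyadic.
Context (R : realType).
Notation lambda := (@lebesgue_measure R).

Lemma expRN_le (m n : nat) : (m <= n)%N -> expR (- n%:R) <= expR (- m%:R) :> R.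
Proof. by move=> mn; rewrite ler_expR lerN2 ler_nat. Qed.

Lemma trivIset_expRN_itv (N : nat) :
  trivIset setT (fun n => `]expR (- (N + n).+1%:R), expR (- (N + n)%:R)[%classic : set R).
Proof.
move=> i j _ _ [t []]; rewrite /= !in_itv/= => /andP[i1 i2] /andP[j1 j2].
wlog ij : i j i1 i2 j1 j2 / (i <= j)%N.
  by move=> H; have [ij|/ltnW ij] := leqP i j; [exact: H|apply/esym; exact: H].
apply/eqP; rewrite eqn_leq ij/= leqNgt; apply/negP => ij'.
have : expR (- (N + j)%:R) <= expR (- (N + i).+1%:R) :> R.
  by apply: expRN_le; rewrite -addnS leq_add2l.
by move: i1 j2; lra.
Qed.

(** On slice n the weight cancels the width, e^n (e^-n - e^-(n+1)) = 1 - e^-1, and disjoint slices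
    charge the integral of [f] separately. Both directions of travel are allowed because either end
    of a curve may be at the corner. *)
Lemma dyadic_lower_bound (a b k : R) (s rho : R -> R) (f : R -> \bar R)
    (w : nat -> R) (N K : nat) : a <= b -> 0 < k ->
  ac_on a b s -> density a b s rho ->
  (forall t, a <= t <= b -> (0 <= f t)%E) -> (forall n, 0 <= w n) ->
  {ae lambda, forall t n, a < t < b ->
    expR (- n.+1%:R) < s t < expR (- n%:R) ->
    ((expR n%:R * w n.+1 * `|rho t|)%:E <= k%:E * f t)%E} ->
  (expR (- N%:R) <= s a /\ s b <= expR (- K%:R)) \/
  (s a <= expR (- K%:R) /\ expR (- N%:R) <= s b) -> (N <= K)%N ->
  ((\sum_(N <= n < K) (1 - expR (- 1)) * w n.+1)%:E <=
    k%:E * \int[lambda]_(t in `[a, b]) f t)%E.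
Proof.
move=> ab k0 acs [irho srho] f0 w0 fw sab NK.
pose A (i : nat) : set R := `]a, b[ `&` (s \o clamp a b) @^-1`
  `]expR (- (N + i).+1%:R), expR (- (N + i)%:R)[%classic.
pose B (i : nat) (t : R) : \bar R := (expR (N + i)%:R * w (N + i).+1 * `|rho t|)%:E.
have B0 i t : (0 <= B i t)%E by rewrite lee_fin !mulr_ge0// expR_ge0.
have mA i : measurable (A i : set (measurableTypeR R)).
  apply: measurableI; first exact: measurable_itv.
  apply: open_measurable; apply: open_comp; last exact: itv_open.
  by move=> t _; exact: ac_on_clamp_continuous.
have mrho (D : set (measurableTypeR R)) :
    measurable_fun D (fun t : measurableTypeR R => `|rho t|%:E).
  apply: measurable_funTS; apply: (measurableT_comp (f := abse) (g := EFin \o rho)) => //.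
  by case/integrableP : irho.
have sE t : a < t < b -> s (clamp a b t) = s t.
  by move=> /andP[at' tb]; rewrite clampE// (ltW at') ltW.
apply: (@le_trans _ _ (\sum_(i < K - N) \int[lambda]_(t in A i) B i t)%E); last first.
  apply: (@integral_ge0_disjoint _ _ R lambda _ _ (K - N) A B k) => //.
  - move=> i j _ _ [t [[_ ti] [_ tj]]].
    by apply: (trivIset_expRN_itv (N := N)) => //; exists ((s \o clamp a b) t).
  - move=> i t [/= + _]; rewrite !in_itv/= => /andP[? ?]; apply/andP; split; lra.
  - move=> i; rewrite (_ : B i = (fun t => (expR (N + i)%:R * w (N + i).+1)%:E * `|rho t|%:E)%E).
      by apply: measurable_funeM; exact: mrho.
    by apply/funext => t; rewrite /B EFinM.
  - move: fw; apply: filterS; first exact: (ae_filter_ringOfSetsType lambda).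
    move=> t H i _ [/= ]; rewrite !in_itv/= => tab.
    by rewrite sE// => st; exact: H.
rewrite -{1}[N]add0n big_addn big_mkord -sumEFin.
apply: lee_sum => i _; rewrite addnC.
rewrite /B; under eq_integral do rewrite EFinM.
rewrite ge0_integralZl//=; last by rewrite lee_fin mulr_ge0// expR_ge0.
apply: (@le_trans _ _ ((expR (N + i)%:R * w (N + i).+1)%:E *
    (expR (- (N + i)%:R) - expR (- (N + i).+1%:R))%:E)%E).
  rewrite -EFinM lee_fin mulrBr !(mulrAC _ (w _)) -!expRD subrr expR0.
  rewrite (_ : (N + i)%:R + - _ = - 1) ?lexx//.
    by rewrite mulrBl.
  by rewrite -[(N + i).+1]addn1 natrD; ring.
apply: lee_wpmul2l; first by rewrite lee_fin mulr_ge0// expR_ge0.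
apply: density_crossing => //.
  by rewrite ltr_expR ltrN2 ltr_nat.
have h1 : expR (- (N + i)%:R) <= expR (- N%:R) :> R by apply: expRN_le; rewrite leq_addr.
have h2 : expR (- K%:R) <= expR (- (N + i).+1%:R) :> R.
  by apply: expRN_le; rewrite -addnS -leq_subRL.
by case: sab => -[? ?]; [left|right]; split; lra.
Qed.

End dyadic.

(** * Pointwise bounds for x^-a.1 y^-a.2 *)

Section kernel.
Context (R : realType).
Implicit Types (a : R * R) (x y m : R).

Lemma kernelE a x y : 0 < x -> 0 < y ->
  x `^ (- a.1) * y `^ (- a.2) = expR (- a.1 * ln x - a.2 * ln y).
Proof. by move=> x0 y0; rewrite /powR !gt_eqF// -expRD !mulNr. Qed.

Lemma kernel_ge a x y n : 0 <= a.1 -> 0 <= a.2 -> a.1 + a.2 <= 2 ->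
  0 < x -> 0 < y -> expR (- n.+1%:R) < x + y < expR (- n%:R) ->
  expR n%:R ^+ 2 * expR (- n.+1%:R * (2 - a.1 - a.2)) <= x `^ (- a.1) * y `^ (- a.2).
Proof.
move=> a1 a2 a12 x0 y0 /andP[s1 s2]; rewrite kernelE// expr2 -!expRD ler_expR.
have xy0 : 0 < x + y by rewrite addr_gt0.
have lx : ln x <= ln (x + y) by rewrite ler_ln ?posrE//; lra.
have ly : ln y <= ln (x + y) by rewrite ler_ln ?posrE//; lra.
have l1 : - n.+1%:R <= ln (x + y) by rewrite -ler_expR lnK ?posrE// ltW.
have l2 : ln (x + y) <= - n%:R by rewrite -ler_expR lnK ?posrE// ltW.
(* With L = ln (x + y), the terms in a.1 L and a.2 L cancel in the sum of the three products; adding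
   - 2 n - 2 L >= 0 gives the claim. *)
have := mulr_ge0 a1 (_ : 0 <= ln (x + y) - ln x).
have := mulr_ge0 a2 (_ : 0 <= ln (x + y) - ln y).
have := mulr_ge0 (_ : 0 <= 2 - a.1 - a.2) (_ : 0 <= ln (x + y) + n.+1%:R).
move=> /(_ _ _) h1 /(_ _) h2 /(_ _) h3.
have {}h1 := h1 ltac:(lra) ltac:(lra).
have {}h2 := h2 ltac:(lra). have {}h3 := h3 ltac:(lra).
by nra.
Qed.

Lemma kernel_le a x y m n : 0 <= a.1 -> 0 <= a.2 -> a.1 + a.2 <= 2 ->
  m <= x -> m <= y -> expR (- n.+1%:R) <= m <= expR (- n%:R) ->
  x `^ (- a.1) * y `^ (- a.2) <= expR n.+1%:R ^+ 2 * expR (- n%:R * (2 - a.1 - a.2)).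
Proof.
move=> a1 a2 a12 mx my /andP[s1 s2].
have m0 : 0 < m by apply: lt_le_trans s1; exact: expR_gt0.
have x0 := lt_le_trans m0 mx. have y0 := lt_le_trans m0 my.
rewrite kernelE// expr2 -!expRD ler_expR.
have lx : ln m <= ln x by rewrite ler_ln ?posrE.
have ly : ln m <= ln y by rewrite ler_ln ?posrE.
have l1 : - n.+1%:R <= ln m by rewrite -ler_expR lnK ?posrE.
have l2 : ln m <= - n%:R by rewrite -ler_expR lnK ?posrE.
(* The claim is the sum of these three products and of 2 (ln m + n + 1) >= 0. *)
have h1 : 0 <= a.1 * (ln x - ln m) by rewrite mulr_ge0//; lra.
have h2 : 0 <= a.2 * (ln y - ln m) by rewrite mulr_ge0//; lra.
have h3 : 0 <= (2 - a.1 - a.2) * (- n%:R - ln m) by rewrite mulr_ge0//; lra.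
by nra.
Qed.

(** A crude bound m^-2, uniform in [a], for the finiteness of the integral defining [Fmu] at a given
    point. *)
Lemma kernel_bounded a x y m : 0 <= a.1 -> 0 <= a.2 -> a.1 + a.2 <= 2 ->
  0 < m <= 1 -> m <= x -> m <= y ->
  x `^ (- a.1) * y `^ (- a.2) <= expR (- 2 * ln m).
Proof.
move=> a1 a2 a12 /andP[m0 m1] mx my.
have x0 := lt_le_trans m0 mx. have y0 := lt_le_trans m0 my.
rewrite kernelE// ler_expR.
have lx : ln m <= ln x by rewrite ler_ln ?posrE.
have ly : ln m <= ln y by rewrite ler_ln ?posrE.
have lm : ln m <= 0 by rewrite ln_le0.
have h1 : 0 <= a.1 * (ln x - ln m) by rewrite mulr_ge0//; lra.
have h2 : 0 <= a.2 * (ln y - ln m) by rewrite mulr_ge0//; lra.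
have h3 : 0 <= (2 - a.1 - a.2) * (0 - ln m) by rewrite mulr_ge0//; lra.
by nra.
Qed.

End kernel.

(** * Comparison of F_mu with T_mu *)

Section weights.
Context (R : realType) (mu : {finite_measure set (R * R)%type -> \bar R}).
Hypothesis hE : forall a, msupp mu a -> [/\ 0 <= a.1, 0 <= a.2 & a.1 + a.2 <= 2].
Local Notation E := (msupp mu).

(** [Rintegral] passes through [fine], which sends infinity to 0, so values of [Fmu] and [Tmu] can
    be compared only after finiteness is known. *)
Lemma integral_msupp_bounded_fin (f : R * R -> R) (M : R) :
  (forall a, E a -> 0 <= f a) ->
  {ae mu, forall a, E a -> f a <= M} ->
  (\int[mu]_(a in E) (f a)%:E)%E \is a fin_num.
Proof.
move=> f0 fM; rewrite ge0_fin_numE; last by apply: integral_ge0 => a Ea; rewrite lee_fin f0.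
apply: (@le_lt_trans _ _ (\int[mu]_(a in E) (cst `|M|%:E) a)%E).
  apply: integral_ge0_ae_le => [a Ea|a _|]; rewrite ?lee_fin ?f0//.
  by apply: ae_imply fM => a fM Ea; rewrite lee_fin (le_trans (fM Ea)) ?ler_norm.
apply: (@le_lt_trans _ _ (\int[mu]_(a in setT) (cst `|M|%:E) a)%E).
  by apply: integral_ge0_mono => a _; rewrite lee_fin.
rewrite integral_cst// lte_mul_pinfty// ?lee_fin//.
by rewrite -ge0_fin_numE// fin_num_measure.
Qed.

Lemma Tmu_fin S : 0 <= S ->
  (\int[mu]_(a in E) (expR (- S * (2 - a.1 - a.2)))%:E)%E \is a fin_num.
Proof.
move=> S0; apply: (@integral_msupp_bounded_fin _ 1) => [a _|].
  exact: expR_ge0.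
apply/aeW => a /hE[h1 h2 h3]; rewrite -[leRHS]expR0 ler_expR mulNr oppr_le0 mulr_ge0//; lra.
Qed.

Lemma Tmu_ge0 S : 0 <= Tmu mu S.
Proof. by apply: Rintegral_ge0 => a _; exact: expR_ge0. Qed.

Lemma Tmu_le S S' : 0 <= S -> S <= S' -> Tmu mu S' <= Tmu mu S.
Proof.
move=> S0 SS'; apply: fine_le; rewrite ?Tmu_fin//; first exact: le_trans SS'.
apply: integral_ge0_ae_le => [a _|a _|].
- by rewrite lee_fin expR_ge0.
- by rewrite lee_fin expR_ge0.
apply/aeW => a /hE[h1 h2 h3]; rewrite lee_fin ler_expR !mulNr lerN2 ler_wpM2r//; lra.
Qed.

Variables (k : nat) (u : R * R -> 'rV[R]_(2 + k) -> R) (cu Cu : R) (p : 'rV[R]_(2 + k)).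
Hypotheses (cu0 : 0 < cu) (cuCu : cu <= Cu).
Hypotheses (u0 : forall a, E a -> 0 < u a p).
Hypothesis (uae : {ae mu, forall a, E a -> cu <= u a p <= Cu}).

Let Cu0 : 0 < Cu. Proof. exact: lt_le_trans cuCu. Qed.

Let F0 a : E a -> 0 <= u a p * xcoord p `^ (- a.1) * ycoord p `^ (- a.2).
Proof. by move=> Ea; rewrite !mulr_ge0 ?powR_ge0// ltW// u0. Qed.

Lemma Fmu_ge0 : 0 <= Fmu mu u p.
Proof. by apply: Rintegral_ge0 => a; exact: F0. Qed.

Lemma Fmu_fin : 0 < xcoord p < 1 -> 0 < ycoord p < 1 ->
  (\int[mu]_(a in E) (u a p * xcoord p `^ (- a.1) * ycoord p `^ (- a.2))%:E)%E
    \is a fin_num.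
Proof.
move=> /andP[x0 x1] /andP[y0 y1].
pose m := Num.min (xcoord p) (ycoord p).
apply: (@integral_msupp_bounded_fin _ (Cu * expR (- 2 * ln m))) => //.
apply: ae_imply uae => a ua Ea; have [h1 h2 h3] := hE Ea.
have /andP[_ uC] := ua Ea.
rewrite -mulrA; apply: ler_pM => //; [exact/ltW/u0|by rewrite mulr_ge0 ?powR_ge0|].
apply: kernel_bounded => //; rewrite ?ge_min ?lexx ?orbT//.
by rewrite lt_min x0 y0/= (ltW x1).
Qed.

Lemma Fmu_ge n : 0 < xcoord p < 1 -> 0 < ycoord p < 1 ->
  expR (- n.+1%:R) < xcoord p + ycoord p < expR (- n%:R) ->
  cu * (expR n%:R ^+ 2 * Tmu mu n.+1%:R) <= Fmu mu u p.
Proof.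
move=> hx hy hs; have /andP[x0 _] := hx; have /andP[y0 _] := hy.
have e0 : 0 < expR n%:R ^+ 2 :> R by rewrite exprn_gt0// expR_gt0.
(* The constant changes sides because [integral_ge0_ae_leZ] has it on the larger integral. *)
rewrite mulrA -ler_pdivlMl ?mulr_gt0// -lee_fin EFinM !fineK ?Tmu_fin ?Fmu_fin//.
apply: integral_ge0_ae_leZ => [|a _|a Ea|].
- by rewrite invr_gt0 mulr_gt0.
- by rewrite lee_fin expR_ge0.
- by rewrite lee_fin F0.
apply: ae_imply uae => a ua Ea; have [h1 h2 h3] := hE Ea.
have /andP[uc _] := ua Ea.
rewrite -EFinM lee_fin ler_pdivlMl ?mulr_gt0// -[leLHS]mulrA -[leRHS]mulrA.
apply: ler_pM => //; last exact: kernel_ge.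
  exact: ltW.
Qed.

Lemma Fmu_le n m : 0 < xcoord p < 1 -> 0 < ycoord p < 1 ->
  m <= xcoord p -> m <= ycoord p -> expR (- n.+1%:R) <= m <= expR (- n%:R) ->
  Fmu mu u p <= Cu * (expR n.+1%:R ^+ 2 * Tmu mu n%:R).
Proof.
move=> hx hy mx my hs.
have e0 : 0 < expR n.+1%:R ^+ 2 :> R by rewrite exprn_gt0// expR_gt0.
rewrite mulrA -lee_fin EFinM !fineK ?Tmu_fin ?Fmu_fin//.
apply: integral_ge0_ae_leZ => [|a Ea|a _|].
- by rewrite mulr_gt0.
- by rewrite lee_fin F0.
- by rewrite lee_fin expR_ge0.
apply: ae_imply uae => a ua Ea; have [h1 h2 h3] := hE Ea.
have /andP[_ uC] := ua Ea.
rewrite -EFinM lee_fin -[leLHS]mulrA -[leRHS]mulrA.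
apply: ler_pM => //; [exact/ltW/u0|by rewrite mulr_ge0 ?powR_ge0|exact: kernel_le hs].
Qed.

End weights.

Section enorm.
Context (R : realType) (n : nat).
Implicit Types v w : 'rV[R]_n.

Lemma enorm_ge0 v : 0 <= enorm v.
Proof. exact: sqrtr_ge0. Qed.

Lemma sqr_enorm v : enorm v ^+ 2 = \sum_(i < n) v 0 i ^+ 2.
Proof. by rewrite sqr_sqrtr// sumr_ge0// => i _; exact: sqr_ge0. Qed.

Lemma coord_enorm v i : `|v 0 i| <= enorm v.
Proof.
rewrite -(@ler_pXn2r _ 2)// ?nnegrE ?enorm_ge0// sqr_enorm real_normK ?num_real//.
by rewrite (bigD1 i)//= lerDl sumr_ge0// => j _; exact: sqr_ge0.
Qed.

Lemma enormZ (c : R) v : enorm (c *: v) = `|c| * enorm v.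
Proof.
rewrite /enorm -sqrtr_sqr -sqrtrM ?sqr_ge0// mulr_sumr; congr Num.sqrt.
by apply: eq_bigr => i _; rewrite mxE exprMn.
Qed.

Lemma enorm0 : enorm (0 : 'rV[R]_n) = 0.
Proof. by rewrite -(scale0r (0 : 'rV[R]_n)) enormZ normr0 mul0r. Qed.

(* The constant 2 avoids Cauchy-Schwarz. *)
Lemma enormD2 v w : enorm (v + w) <= 2 * (enorm v + enorm w).
Proof.
have v0 := enorm_ge0 v; have w0 := enorm_ge0 w.
rewrite -(@ler_pXn2r _ 2)// ?nnegrE ?enorm_ge0 ?mulr_ge0 ?addr_ge0//.
apply: (@le_trans _ _ (2 * (enorm v ^+ 2 + enorm w ^+ 2))); last by nra.
rewrite !sqr_enorm -big_split mulr_sumr /=; apply: ler_sum => i _; rewrite mxE.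
have := sqr_ge0 (v 0 i - w 0 i); nra.
Qed.

Lemma enorm_convex (t : R) v w : 0 <= t <= 1 ->
  enorm ((1 - t) *: v + t *: w) ^+ 2 <= (1 - t) * enorm v ^+ 2 + t * enorm w ^+ 2.
Proof.
move=> /andP[t0 t1]; rewrite !sqr_enorm !mulr_sumr -big_split/=.
apply: ler_sum => i _; rewrite !mxE.
have h : 0 <= (t * (1 - t)) * (v 0 i - w 0 i) ^+ 2.
  by rewrite mulr_ge0 ?sqr_ge0// mulr_ge0//; lra.
nra.
Qed.

End enorm.

(** * Speed estimates and the lower bound for lengths *)

Section curves.
Context (R : realType) (k : nat) (mu : {finite_measure set (R * R)%type -> \bar R}).
Variables (u : R * R -> 'rV[R]_(2 + k) -> R) (g0 : 'rV[R]_(2 + k) -> 'M[R]_(2 + k)).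
Variables (c0 C0 cu Cu : R) (X : set 'rV[R]_(2 + k)).
Notation lambda := (@lebesgue_measure R).
Hypothesis hE : forall a, msupp mu a -> [/\ 0 <= a.1, 0 <= a.2 & a.1 + a.2 <= 2].
Hypotheses (hc0 : 0 < c0) (hC0 : c0 <= C0) (hcu : 0 < cu) (hCu : cu <= Cu).
Hypothesis hX : forall p, X p -> 0 < xcoord p < 1 /\ 0 < ycoord p < 1.
Hypothesis hg0 : forall p v, X p ->
  c0 * enorm v ^+ 2 <= metric_sq g0 p v <= C0 * enorm v ^+ 2.
Hypothesis hu0 : forall a p, msupp mu a -> X p -> 0 < u a p.
Hypothesis huae : {ae mu, forall a, msupp mu a -> forall p, X p -> cu <= u a p <= Cu}.
Let g := gmu mu u g0.

Let C0_gt0 : 0 < C0. Proof. exact: lt_le_trans hC0. Qed.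
Let Cu_gt0 : 0 < Cu. Proof. exact: lt_le_trans hCu. Qed.

Lemma metric_sq_gmu p v : metric_sq g p v = Fmu mu u p * metric_sq g0 p v.
Proof. by rewrite /metric_sq /g /gmu -scalemxAr -scalemxAl mxE. Qed.

Let uae p : X p -> {ae mu, forall a, msupp mu a -> cu <= u a p <= Cu}.
Proof. by move=> Xp; apply: ae_imply huae => a H Ea; exact: H. Qed.

Let sqrt_factor (c e T r : R) : 0 <= c -> 0 <= e -> 0 <= T -> 0 <= r ->
  Num.sqrt (c * (e ^+ 2 * T) * r ^+ 2) = Num.sqrt c * (e * Num.sqrt T) * r.
Proof.
move=> c0' e0 T0 r0; rewrite sqrtrM ?mulr_ge0 ?sqr_ge0//.
by rewrite (sqrtrM _ c0') (sqrtrM _ (sqr_ge0 e)) !sqrtr_sqr !ger0_norm.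
Qed.

Lemma speed_ge p v n : X p -> expR (- n.+1%:R) < xcoord p + ycoord p < expR (- n%:R) ->
  Num.sqrt (c0 * cu) * (expR n%:R * Num.sqrt (Tmu mu n.+1%:R)) * enorm v <=
  Num.sqrt (metric_sq g p v).
Proof.
move=> Xp hs; have [hx hy] := hX Xp; have /andP[h1 _] := hg0 v Xp.
rewrite -sqrt_factor ?mulr_ge0 ?expR_ge0 ?Tmu_ge0 ?enorm_ge0 ?(ltW hc0) ?(ltW hcu)//.
rewrite ler_wsqrtr// metric_sq_gmu.
have := Fmu_ge hE hcu (fun a Ea => hu0 Ea Xp) (uae Xp) hx hy hs.
set F := Fmu _ _ _; set T := (_ ^+ 2 * _) => FT.
have T0 : 0 <= T by rewrite mulr_ge0 ?sqr_ge0 ?Tmu_ge0.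
rewrite (_ : c0 * cu * T * _ = (cu * T) * (c0 * enorm v ^+ 2)); last ring.
by apply: ler_pM => //; rewrite mulr_ge0 ?sqr_ge0// ltW.
Qed.

Lemma speed_le p v n m : X p -> m <= xcoord p -> m <= ycoord p ->
  expR (- n.+1%:R) <= m <= expR (- n%:R) ->
  Num.sqrt (metric_sq g p v) <=
  Num.sqrt (C0 * Cu) * (expR n.+1%:R * Num.sqrt (Tmu mu n%:R)) * enorm v.
Proof.
move=> Xp mx my hm; have [hx hy] := hX Xp; have /andP[h0 h1] := hg0 v Xp.
rewrite -sqrt_factor ?mulr_ge0 ?expR_ge0 ?Tmu_ge0 ?enorm_ge0 ?(ltW C0_gt0) ?(ltW Cu_gt0)//.
rewrite ler_wsqrtr// metric_sq_gmu.
have := Fmu_le hE hcu hCu (fun a Ea => hu0 Ea Xp) (uae Xp) hx hy mx my hm.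
set F := Fmu _ _ _; set T := (_ ^+ 2 * _) => FT.
rewrite (_ : C0 * Cu * T * _ = (Cu * T) * (C0 * enorm v ^+ 2)); last ring.
apply: ler_pM => //; first exact: Fmu_ge0 (fun a Ea => hu0 Ea Xp).
by apply: le_trans h0; rewrite mulr_ge0 ?sqr_ge0// ltW.
Qed.

(** [dyadic_lower_bound] is applied to x + y. The factor 2 comes from |v_x + v_y| <= 2 |v|, the root
    of c0 cu from [speed_ge]. *)
Lemma curve_length_lower_bound (a b : R) (gamma : R -> 'rV[R]_(2 + k)) (N K : nat)
    (s := fun t => xcoord (gamma t) + ycoord (gamma t)) :
  a <= b -> ac_curve_in X `[a, b] gamma -> (N <= K)%N ->
  (expR (- N%:R) <= s a /\ s b <= expR (- K%:R)) \/
  (s a <= expR (- K%:R) /\ expR (- N%:R) <= s b) ->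
  ((\sum_(N <= n < K) (1 - expR (- 1)) * Num.sqrt (Tmu mu n.+1%:R))%:E <=
   (2 / Num.sqrt (c0 * cu))%:E * curve_length g `[a, b] gamma)%E.
Proof.
move=> ab [gX gac] NK hs.
have acg : abs_continuous a b gamma by apply: gac; rewrite ?in_itv/= ?lexx ?ab.
have c0u : 0 < Num.sqrt (c0 * cu) by rewrite sqrtr_gt0 mulr_gt0.
have coordE (p : 'rV[R]_(2 + k)) : xcoord p = p 0 (lshift k 0) /\ ycoord p = p 0 (lshift k 1).
  by rewrite /xcoord /ycoord !mxE.
have aci i : ac_on a b (fun t => gamma t 0 i).
  apply: abs_continuous_ac_on ltr01 _ acg => t t'; rewrite mul1r.
  by have := coord_enorm (gamma t' - gamma t) i; rewrite !mxE.
have sumle (v : 'rV[R]_(2 + k)) : `|v 0 (lshift k 0) + v 0 (lshift k 1)| <= 2 * enorm v.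
  by rewrite (le_trans (ler_normD _ _))//; have := coord_enorm v (lshift k 0);
    have := coord_enorm v (lshift k 1); lra.
have acs : ac_on a b s.
  apply: (@abs_continuous_ac_on _ _ a b gamma s 2 _ _ acg) => // t t'.
  apply: le_trans (sumle (gamma t' - gamma t)); rewrite /s !(coordE _).1 !(coordE _).2 !mxE.
  by rewrite opprD addrACA.
have [rho rhoP] := ac_on_density ab acs.
have drho := density_derivable rhoP.
(* Differentiability in all coordinates, not only of x + y, is needed before the entries of
   [derive1 gamma] can be read off. *)
have dco : {ae lambda, forall t, forall i, a < t < b -> derivable (fun t => gamma t 0 i) t 1}.
  apply: ae_forall_ord => i; have [r rP] := ac_on_density ab (aci i).
  by apply: ae_imply (density_derivable rP) => t H tab; have [] := H tab.
apply: (dyadic_lower_bound (w := fun n => Num.sqrt (Tmu mu n%:R)) ab _ acs rhoP) => //.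
  by rewrite divr_gt0.
have {}dco := @filterI _ _ (ae_filter_ringOfSetsType lambda) _ _ drho dco.
apply: ae_imply dco => t [h1 h2] n tab hst.
have [ds <-] := h1 tab.
have dg : derivable gamma t 1 by apply/derivable_mxP => i j; rewrite (ord1 i); exact: h2.
have Xt : X (gamma t) by apply: gX; rewrite in_itv/=; case/andP: tab => /ltW -> /ltW ->.
have := speed_ge (derive1 gamma t) Xt hst.
rewrite -EFinM lee_fin => h.
have -> : derive1 s t = (derive1 gamma t) 0 (lshift k 0) + (derive1 gamma t) 0 (lshift k 1).
  rewrite !derive1E (derive_mx dg) !mxE -deriveD; [|exact: h2..].
  by congr ('D_1 _ t); apply/funext => x; rewrite /s (coordE _).1 (coordE _).2.
apply: le_trans (ler_wpM2l _ h); last by rewrite ltW// divr_gt0.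
set W := expR n%:R * _.
rewrite (_ : _ * (_ * W * _) = W * (2 * enorm (derive1 gamma t))); last first.
  by field; rewrite gt_eqF.
apply: ler_wpM2l; last exact: sumle.
by rewrite mulr_ge0 ?expR_ge0 ?sqrtr_ge0.
Qed.

End curves.

(** * The upper bound along an affine minorant *)

Section upper.
Context (R : realType).
Notation lambda := (@lebesgue_measure R).

Lemma unit_itv_measure (n : nat) : lambda (`[n%:R, n.+1%:R[%classic : set R) = 1%E.
Proof.
rewrite lebesgue_measure_itv/= lte_fin ltr_nat ltnSn -EFinB.
by rewrite -natr1 addrAC subrr add0r.
Qed.

Lemma expRN_slice (x : R) (N : nat) : 0 < x <= expR (- N%:R) ->
  exists i, expR (- (N + i).+1%:R) < x <= expR (- (N + i)%:R).
Proof.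
move=> /andP[x0 xN]; pose n := Num.truncn (- ln x).
have lx : N%:R <= - ln x by rewrite lerNr -ler_expR lnK ?posrE.
have lx0 : 0 <= - ln x by apply: le_trans lx.
have /andP[n1 n2] := truncn_itv lx0.
have Nn : (N <= n)%N by rewrite truncn_ge_nat.
exists (n - N)%N; rewrite subnKC//.
by rewrite -{1}[x]lnK ?posrE// -{2}[x]lnK ?posrE// ltr_expR ler_expR lerNr n1 ltrNl n2.
Qed.

(** Both signs of [al] occur, for segments that leave the corner and for those that approach it. *)
Lemma affine_slice_measure (al be l m : R) : al != 0 -> l <= m ->
  let A := [set t | l < al * t + be <= m] in
  measurable (A : set (measurableTypeR R)) /\ lambda A = ((m - l) / `|al|)%:E.
Proof.
move=> al0 lm A.
have [al_gt0|al_lt0|al_eq0] := ltgtP 0 al; last by rewrite al_eq0 eqxx in al0.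
  have -> : A = `](l - be) / al, (m - be) / al]%classic.
    by apply/seteqP; split=> t; rewrite /A /= in_itv/= ltr_pdivrMr// ler_pdivlMr//
      [t * al]mulrC ltrBlDr lerBrDr.
  split; first exact: measurable_itv.
  rewrite lebesgue_measure_itv/= lte_fin ltr_pM2r ?invr_gt0// ltrD2r gtr0_norm//.
  case: ifPn => [_|]; first by rewrite -EFinB; congr _%:E; field; rewrite gt_eqF.
  by rewrite -leNgt => ml; rewrite (_ : m = l) ?subrr ?mul0r//; apply/eqP; rewrite eq_le ml lm.
have -> : A = `[(m - be) / al, (l - be) / al[%classic.
  by apply/seteqP; split=> t; rewrite /A /= in_itv/= ltr_ndivlMr// ler_ndivrMr//
      [t * al]mulrC ltrBlDr lerBrDr andbC.
split; first exact: measurable_itv.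
rewrite lebesgue_measure_itv/= lte_fin ltr_nM2r ?invr_lt0// ltrD2r ltr0_norm//.
case: ifPn => [_|]; first by rewrite -EFinB; congr _%:E; field; rewrite lt_eqF.
by rewrite -leNgt => ml; rewrite (_ : m = l) ?subrr ?mul0r//; apply/eqP; rewrite eq_le ml lm.
Qed.

(** An affine function of slope [al] spends at most time e^-n / |al| in slice n. Hence |al| cancels,
    and the slice contributes at most k e^(n+1) e^-n w n = k e w n. *)
Lemma dyadic_upper_bound (D : set R) (al be k : R) (f : R -> \bar R) (w : nat -> R) (N : nat) :
  al != 0 -> 0 < k -> (forall n, 0 <= w n) ->
  (forall t, D t -> 0 < al * t + be <= expR (- N%:R)) ->
  (forall t, D t -> (0 <= f t)%E) ->
  (forall t n, D t -> expR (- n.+1%:R) <= al * t + be <= expR (- n%:R) ->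
     (f t <= (k * `|al| * (expR n.+1%:R * w n))%:E)%E) ->
  (\int[lambda]_(t in D) f t <= (k * expR 1)%:E * \sum_(N <= n <oo) (w n)%:E)%E.
Proof.
move=> al0 k0 w0 Dphi f0 fw.
pose A i := [set t | expR (- (N + i).+1%:R) < al * t + be <= expR (- (N + i)%:R)].
have Aprop i : measurable (A i : set (measurableTypeR R)) /\
    lambda (A i) = ((expR (- (N + i)%:R) - expR (- (N + i).+1%:R)) / `|al|)%:E.
  by apply: affine_slice_measure => //; exact: expRN_le.
have DA : D `<=` \bigcup_i A i.
  by move=> t Dt; have [i Ai] := expRN_slice (Dphi _ Dt); exists i.
apply: (le_trans (@integral_ge0_cover _ _ R lambda _ _ A (fun i => (Aprop i).1) DA f0)).
rewrite -nneseries_addn//.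
rewrite -nneseriesZl//; last by move=> i _; rewrite lee_fin.
apply: lee_nneseries => [i _ _|i _].
  by apply: integral_ge0 => t [_]; exact: f0.
have [mA lA] := Aprop i.
set M := k * `|al| * (expR (N + i).+1%:R * w (N + i)%N).
have M0 : 0 <= M by rewrite !mulr_ge0// ?expR_ge0// ltW.
apply: (@le_trans _ _ (\int[lambda]_(t in A i) (cst M%:E) t)%E).
  apply: integral_ge0_mono => [t [_ Dt]|t _|t [At Dt] _].
  - exact: f0.
  - by rewrite lee_fin.
  - by split => //; apply: fw => //; case/andP: At => /ltW -> ->.
rewrite integral_cst// [X in (_ * X <= _)%E]lA -!EFinM lee_fin (addnC i N).
apply: (@le_trans _ _ (M * (expR (- (N + i)%:R) / `|al|))).
  apply: ler_wpM2l => //; apply: ler_wpM2r; first by rewrite invr_ge0.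
  by rewrite lerBlDr lerDl expR_ge0.
have eE : expR (N + i).+1%:R * expR (- (N + i)%:R) = expR 1 :> R.
  by rewrite -expRD -[(N + i).+1]addn1 natrD addrAC subrr add0r.
rewrite -eE /M le_eqVlt; apply/orP; left; apply/eqP.
by field; rewrite normr_eq0.
Qed.

End upper.

(** * The integral test *)

Section series.
Context (R : realType) (mu : {finite_measure set (R * R)%type -> \bar R}).
Hypothesis hE : forall a, msupp mu a -> [/\ 0 <= a.1, 0 <= a.2 & a.1 + a.2 <= 2].
Notation lambda := (@lebesgue_measure R).
Let w (n : nat) : R := Num.sqrt (Tmu mu n%:R).
Let w0 n : 0 <= w n. Proof. exact: sqrtr_ge0. Qed.

Lemma sqrt_Tmu_le S S' : 0 <= S -> S <= S' -> Num.sqrt (Tmu mu S') <= Num.sqrt (Tmu mu S).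
Proof. by move=> S0 SS'; rewrite ler_wsqrtr// Tmu_le. Qed.

(** The index is shifted because the lower bound on slice n involves T_mu (n + 1). *)
Lemma series_fin_partial (N : nat) (M : R) :
  (forall K, (N <= K)%N -> \sum_(N <= n < K) w n.+1 <= M) ->
  (\sum_(n <oo) (w n)%:E < +oo)%E.
Proof.
move=> H; rewrite (nneseries_split 0 N.+1) ?add0n; last by move=> n _; rewrite lee_fin.
rewrite sumEFin lte_add_pinfty ?ltry//.
apply: (@le_lt_trans _ _ M%:E); last exact: ltry.
apply: lime_le; first by apply: is_cvg_nneseries => n _ _; rewrite lee_fin.
near=> K; rewrite sumEFin lee_fin.
have NK : (N < K)%N by near: K; exact: nbhs_infty_gt.
apply: le_trans (H K.-1 _); last by rewrite -ltnS prednK// (leq_trans _ NK).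
by rewrite -{1}(prednK (leq_trans (ltn0Sn _) NK)) big_add1/= lexx.
Unshelve. all: by end_near. Qed.

Lemma series_integral_fin : (\sum_(n <oo) (w n)%:E < +oo)%E ->
  (\int[lambda]_(S in `[0%R, +oo[) (Num.sqrt (Tmu mu S))%:E < +oo)%E.
Proof.
apply: le_lt_trans.
pose A (i : nat) : set R := `[i%:R, i.+1%:R[%classic.
have mA i : measurable (A i : set (measurableTypeR R)) by exact: measurable_itv.
apply: (le_trans (@integral_ge0_cover _ _ R lambda _ _ A mA _ _)).
- move=> S /=; rewrite in_itv/= andbT => S0; exists (Num.truncn S) => //=.
  by rewrite /A/= in_itv/=; exact: truncn_itv.
- by move=> S _; rewrite lee_fin sqrtr_ge0.
apply: lee_nneseries => [i _ _|i _].
  by apply: integral_ge0 => S _; rewrite lee_fin sqrtr_ge0.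
apply: (@le_trans _ _ (\int[lambda]_(S in A i) (cst (w i)%:E) S)%E).
  apply: integral_ge0_mono => [S _|S _|S [AS _] _].
  - by rewrite lee_fin sqrtr_ge0.
  - by rewrite lee_fin.
  - split=> //; rewrite lee_fin; apply: sqrt_Tmu_le => //.
    by move: AS; rewrite /A/= in_itv/= => /andP[].
by rewrite integral_cst// [X in (_ * X <= _)%E](unit_itv_measure R i) mule1.
Qed.

(** The unit intervals start at the first integer above [S0]; on [n, n + 1[ the integrand is at
    least its value at n + 1. *)
Lemma integral_series_fin (S0 : R) : 0 <= S0 ->
  (\int[lambda]_(S in `[S0, +oo[) (Num.sqrt (Tmu mu S))%:E < +oo)%E ->
  (\sum_(n <oo) (w n)%:E < +oo)%E.
Proof.
move=> S00 Hfin; pose N := (Num.truncn S0).+1.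
have S0N : S0 <= N%:R by exact/ltW/truncnS_gt.
set J := (\int[_]_(_ in _) _)%E in Hfin.
have J0 : (0 <= J)%E by apply: integral_ge0 => S _; rewrite lee_fin sqrtr_ge0.
have Jfin : J \is a fin_num by rewrite ge0_fin_numE.
apply: (@series_fin_partial N (fine J)) => K NK.
rewrite -lee_fin fineK//.
pose A (i : nat) : set R := `[(N + i)%:R, (N + i).+1%:R[%classic.
have mA i : measurable (A i : set (measurableTypeR R)) by exact: measurable_itv.
have := @integral_ge0_disjoint _ _ R lambda `[S0, +oo[%classic
  (fun S => (Num.sqrt (Tmu mu S))%:E) (K - N) A (fun i => cst (w (N + i).+1)%:E) 1 ltr01.
rewrite mul1e -/J => H; apply: le_trans (H _ _ mA _ _ _ _).
- rewrite -{1}[N]add0n big_addn big_mkord -sumEFin; apply: lee_sum => i _.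
  rewrite integral_cst// [X in (_ <= _ * X)%E](unit_itv_measure R (N + i)) mule1.
  by rewrite addnC.
- by move=> S _; rewrite lee_fin sqrtr_ge0.
- move=> i j _ _ [S []]; rewrite /A/= !in_itv/= => /andP[i1 i2] /andP[j1 j2].
  apply/eqP; rewrite -(eqn_add2l N) eqn_leq -[(N + i <= _)%N]ltnS -[(N + j <= _)%N]ltnS -!(ltr_nat R).
  by rewrite (le_lt_trans i1 j2) (le_lt_trans j1 i2).
- move=> i S; rewrite /A/= !in_itv/= andbT => /andP[i1 _].
  by rewrite (le_trans S0N)// (le_trans _ i1)// ler_nat leq_addr.
- by move=> i; exact: measurable_cst.
- by move=> i S _; rewrite lee_fin.
- apply/aeW => S i _; rewrite /A/= in_itv/= => /andP[i1 i2].
  by rewrite mul1e lee_fin sqrt_Tmu_le ?(le_trans _ i1)// ltW.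
Qed.

End series.

(** * Absolutely continuous vector curves *)

Section abs_continuous_theory.
Context (R : realType) (n : nat).
Implicit Types (a b c d : R) (f h : R -> 'rV[R]_n).

Lemma abs_continuousS a b c d f : a <= c -> d <= b ->
  abs_continuous a b f -> abs_continuous c d f.
Proof.
move=> ac db acf e e0; have [r r0 fr] := acf e e0; exists r => // m s t st.
by apply: fr => i; have [h1 [h2 h3]] := st i; split; [|split]; lra.
Qed.

Lemma abs_continuousD a b f h :
  abs_continuous a b f -> abs_continuous a b h -> abs_continuous a b (f \+ h).
Proof.
move=> acf ach e e0.
(* With the factor 2 of [enormD2], 2 (e / 4 + e / 4) = e. *)
have e40 : 0 < e / 4 by rewrite divr_gt0.
have [r r0 fr] := acf _ e40; have [r' r'0 hr] := ach _ e40.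
exists (Num.min r r'); first by rewrite lt_min r0.
move=> m s t st dis; rewrite lt_min => /andP[Lr Lr'].
apply: (@le_lt_trans _ _ (\sum_(i < m)
    2 * (enorm (f (t i) - f (s i)) + enorm (h (t i) - h (s i))))).
  by apply: ler_sum => i _ /=; rewrite opprD addrACA; exact: enormD2.
rewrite -mulr_sumr big_split/=.
by have := fr _ _ _ st dis Lr; have := hr _ _ _ st dis Lr'; lra.
Qed.

Lemma abs_continuous_cst a b (v : 'rV[R]_n) : abs_continuous a b (fun=> v).
Proof.
move=> e e0; exists 1 => // m s t _ _ _.
by rewrite big1// => i _; rewrite subrr enorm0.
Qed.

(* If ]s i, t i[ and ]s j, t j[ are disjoint, so are their images: an
   common point of ]phi (s i), phi (t i)[ and ]phi (s j), phi (t j)[ would force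
   s i, s j < t i, t j by monotonicity, and the sources would overlap. *)
Lemma abs_continuous_comp a b c d f (phi : R -> R) :
  {homo phi : x y / x <= y} -> (forall x y, x <= y -> phi y - phi x <= y - x) ->
  (forall x, a <= x <= b -> c <= phi x <= d) ->
  abs_continuous c d f -> abs_continuous a b (f \o phi).
Proof.
move=> nd lip ab acf e e0; have [r r0 fr] := acf e e0; exists r => // m s t st dis sr.
apply: (fr m (phi \o s) (phi \o t)).
- move=> i; have [h1 [h2 h3]] := st i.
  have /andP[-> _] : c <= phi (s i) <= d by apply: ab; apply/andP; split; lra.
  have /andP[_ ->] : c <= phi (t i) <= d by apply: ab; apply/andP; split; lra.
  by split => //; split => //; exact: nd.
- move=> i j ij; apply/seteqP; split => // x []/=; rewrite !in_itv/= => /andP[i1 i2] /andP[j1 j2].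
  have sti : s i < t i by rewrite ltNge; apply/negP => /nd; lra.
  have stj : s j < t j by rewrite ltNge; apply/negP => /nd; lra.
  have sitj : s i < t j by rewrite ltNge; apply/negP => /nd; lra.
  have sjti : s j < t i by rewrite ltNge; apply/negP => /nd; lra.
  pose l := Num.max (s i) (s j); pose u := Num.min (t i) (t j).
  have lu : l < u by rewrite gt_max !lt_min sti sitj sjti stj.
  have l1 : s i <= l by rewrite le_max lexx.
  have l2 : s j <= l by rewrite le_max lexx orbT.
  have u1 : u <= t i by rewrite ge_min lexx.
  have u2 : u <= t j by rewrite ge_min lexx orbT.
  have : (`]s i, t i[ `&` `]s j, t j[)%classic ((l + u) / 2).
    by split; rewrite /= in_itv/=; apply/andP; split; lra.
  by rewrite (dis i j ij).
- apply: le_lt_trans sr; apply: ler_sum => i _ /=; apply: lip.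
  by have [_ []] := st i.
Qed.

Lemma abs_continuous_affine a b (p v : 'rV[R]_n) :
  abs_continuous a b (fun t => p + t *: v).
Proof.
move=> e e0; have v0 := enorm_ge0 v; have v1 : 0 < enorm v + 1 by lra.
exists (e / (enorm v + 1)); first by rewrite divr_gt0.
move=> m s t st _; rewrite ltr_pdivlMr//; apply: le_lt_trans.
rewrite mulr_suml; apply: ler_sum => i _; have [_ [sti _]] := st i.
rewrite opprD addrACA subrr add0r -scalerBl enormZ ger0_norm ?subr_ge0//.
by apply: ler_wpM2l; rewrite ?subr_ge0//; lra.
Qed.

Lemma derive1_affine (p v : 'rV[R]_n) t : derive1 (fun t => p + t *: v) t = v.
Proof.
rewrite /derive1; apply/cvg_lim; first exact: norm_hausdorff.
apply: cvg_near_cst; near=> h.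
have h0 : h != 0 by near: h; exact: nbhs_dnbhs_neq.
by rewrite opprD addrACA subrr add0r -scalerBl addrK scalerA mulVf// scale1r.
Unshelve. all: by end_near. Qed.

End abs_continuous_theory.

(** * Concatenation and the triangle inequality *)

Section intrinsic_distance.
Context (R : realType) (n : nat) (g : 'rV[R]_n -> 'M[R]_n) (X : set 'rV[R]_n).
Notation lambda := (@lebesgue_measure R).
Implicit Types (a b c e : R) (f : R -> 'rV[R]_n).

Let speed f (t : R) : \bar R := (Num.sqrt (metric_sq g (f t) (derive1 f t)))%:E.

Let curve_lengthE f (J : interval R) :
  curve_length g J f = (\int[lambda]_(t in [set` J]) speed f t)%E.
Proof. by []. Qed.

Lemma curve_length_ge0 (J : interval R) f : (0 <= curve_length g J f)%E.
Proof. by apply: integral_ge0 => t _; rewrite lee_fin sqrtr_ge0. Qed.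

Lemma intrinsic_dist_ge0 p q : (0 <= intrinsic_dist g X p q)%E.
Proof.
by apply: le_ereal_inf_tmp => _ [a [b [f [_ _ _ _ ->]]]]; exact: curve_length_ge0.
Qed.

Lemma intrinsic_dist_le_length a b f : a <= b -> ac_curve_in X `[a, b] f ->
  (intrinsic_dist g X (f a) (f b) <= curve_length g `[a, b] f)%E.
Proof. by move=> ab acf; apply: ereal_inf_lbound; exists a, b, f. Qed.

Lemma near_eq_derive1 f f' t : (\forall s \near t, f s = f' s) ->
  derive1 f t = derive1 f' t.
Proof. by move=> ff'; rewrite !derive1E; exact: near_eq_derive. Qed.

Lemma derive1_shift f (tau t : R) :
  derive1 (fun s => f (s + tau)) t = derive1 f (t + tau).
Proof. by rewrite /derive1; under eq_fun do rewrite -addrA. Qed.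

Lemma curve_concat a b c e f1 f2 : a <= b -> c <= e -> f1 b = f2 c ->
  ac_curve_in X `[a, b] f1 -> ac_curve_in X `[c, e] f2 ->
  exists f, [/\ ac_curve_in X `[a, b + (e - c)] f, f a = f1 a, f (b + (e - c)) = f2 e &
    (curve_length g `[a, (b + (e - c))%R] f <=
       curve_length g `[a, b] f1 + curve_length g `[c, e] f2)%E].
Proof.
move=> ab ce f12 [X1 ac1] [X2 ac2]; pose tau := c - b.
(* Each curve is frozen beyond the junction, so absolute continuity follows from sums and
   compositions without cutting subintervals at [b]. *)
pose f t := f1 (Num.min t b) + (f2 (Num.max (t + tau) c) - f1 b).
have fl t : t <= b -> f t = f1 t.
  move=> tb; rewrite /f (min_idPl tb) (max_idPr _) ?f12 ?subrr ?addr0//.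
  by rewrite /tau; lra.
have fr t : b <= t -> f t = f2 (t + tau).
  move=> bt; rewrite /f (min_idPr bt) (max_idPl _) ?subrKC//.
  by rewrite /tau; lra.
exists f; split.
- split=> [t|s t].
    rewrite in_itv/= => /andP[at' te]; have [tb|bt] := leP t b.
      by rewrite fl//; apply: X1; rewrite in_itv/= at' tb.
    rewrite fr ?ltW//; apply: X2; rewrite in_itv/= /tau; apply/andP; split; lra.
  rewrite !in_itv/= => /andP[as' se] /andP[at' te] st.
  apply: (@abs_continuousS _ _ a (b + (e - c)) s t f as' te).
  apply: abs_continuousD.
    apply: (@abs_continuous_comp _ _ _ _ a b f1 (fun t => Num.min t b)).
    + by move=> x y xy; exact: le_min2.
    + by move=> x y xy; rewrite /Num.min; repeat case: ifPn; rewrite -?leNgt; lra.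
    + by move=> x /andP[ax xb]; rewrite ge_min lexx orbT le_min ax ab.
    + by apply: ac1; rewrite ?in_itv/= ?lexx ?ab.
  apply: abs_continuousD; last exact: abs_continuous_cst.
  apply: (@abs_continuous_comp _ _ _ _ c e f2 (fun t => Num.max (t + tau) c)).
  + by move=> x y xy; apply: le_max2 => //; rewrite lerD2r.
  + by move=> x y xy; rewrite /Num.max; repeat case: ifPn; rewrite -?leNgt; lra.
  + move=> x /andP[ax xb]; rewrite le_max lexx orbT ge_max ce andbT/= /tau; lra.
  + by apply: ac2; rewrite ?in_itv/= ?lexx ?ce.
- by rewrite fl.
- by rewrite fr ?lerDl ?subr_ge0// /tau; congr f2; lra.
- clearbody f; pose F := speed f; pose F1 := speed f1; pose F2 := speed f2.
  have F0 t : (0 <= F t)%E by rewrite lee_fin sqrtr_ge0.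
  have F10 t : (0 <= F1 t)%E by rewrite lee_fin sqrtr_ge0.
  have F20 t : (0 <= F2 t)%E by rewrite lee_fin sqrtr_ge0.
  have FF1 t : t < b -> F t = F1 t.
    move=> tb; rewrite /F /F1 /speed (fl t (ltW tb)) (@near_eq_derive1 f f1)//.
    by near=> s; apply: fl; apply/ltW; near: s; exact: lt_nbhsl.
  have FF2 t : b < t -> F t = F2 (t + tau).
    move=> bt; rewrite /F /F2 /speed (fr t (ltW bt)) -derive1_shift.
    rewrite (@near_eq_derive1 f (fun s => f2 (s + tau)))//.
    by near=> s; apply: fr; apply/ltW; near: s; exact: lt_nbhsr.
  pose A : set R := `]-oo, b]%classic; pose B : set R := `]b, +oo[%classic.
  have mA : measurable (A : set (measurableTypeR R)) by exact: measurable_itv.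
  have mB : measurable (B : set (measurableTypeR R)) by exact: measurable_itv.
  pose D : set R := `[a, b + (e - c)]%classic.
  rewrite !curve_lengthE -/F -/F1 -/F2 -/D; clearbody F F1 F2.
  have DAB : D `<=` A `|` B.
    move=> t _; have [tb|bt] := leP t b; [left|right].
      by rewrite /A/= in_itv.
    by rewrite /B/= in_itv/= bt.
  have cover := @integral_ge0_cover2 _ _ R lambda D F A B mA mB DAB (fun t _ => F0 t).
  apply: (le_trans cover).
  apply: leeD.
    apply: (@le_trans _ _ (\int[lambda]_(t in A `&` D) F1 t)%E).
      apply: integral_ge0_ae_le => //.
      (* The derivative of [f] at the junction is unrelated to that of [f1], which matters at one
         point only. *)
      exists [set b]; split.
      + exact: measurable_set1.
      + exact: lebesgue_measure_set1.
      + move=> t /= nH; apply: contrapT => /eqP tb; apply: nH => -[At _].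
        by rewrite FF1// lt_neqAle tb/=; move: At; rewrite /A/= in_itv/=.
    apply: integral_ge0_mono => // t [At Dt] _; split => //.
    by move: At Dt; rewrite /A /D /= !in_itv/= => -> /andP[->].
  apply: le_trans (@integral_ge0_translation R tau `[c, e]%classic F2 _) => //.
  apply: integral_ge0_mono => // t [Bt Dt] _.
  move: Bt Dt; rewrite /B /D /= !in_itv/= andbT => bt /andP[_ te]; split.
    by apply/andP; split; rewrite /tau; lra.
  by rewrite FF2.
Unshelve. all: by end_near. Qed.

Lemma intrinsic_dist_triangle p q r :
  (intrinsic_dist g X p r <= intrinsic_dist g X p q + intrinsic_dist g X q r)%E.
Proof.
have h1 := intrinsic_dist_ge0 p q; have h2 := intrinsic_dist_ge0 q r.
have [->|fin1] := eqVneq (intrinsic_dist g X p q) +oo%E.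
  by rewrite addye ?leey// gt_eqF// (lt_le_trans _ h2).
have [->|fin2] := eqVneq (intrinsic_dist g X q r) +oo%E.
  by rewrite addey ?leey// gt_eqF// (lt_le_trans _ h1).
apply/lee_addgt0Pr => d d0.
have d20 : 0 < d / 2 by rewrite divr_gt0.
have fn1 : intrinsic_dist g X p q \is a fin_num by rewrite ge0_fin_numE// ltey.
have fn2 : intrinsic_dist g X q r \is a fin_num by rewrite ge0_fin_numE// ltey.
have [_ [a [b [f1 [ab ac1 <- f1b ->]]]] l1] := lb_ereal_inf_adherent d20 fn1.
have [_ [c [e [f2 [ce ac2 f2c <- ->]]]] l2] := lb_ereal_inf_adherent d20 fn2.
have f12 : f1 b = f2 c by rewrite f1b f2c.
have [f [acf fa fb fl]] := curve_concat ab ce f12 ac1 ac2.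
have abe : a <= b + (e - c) by lra.
have := intrinsic_dist_le_length abe acf; rewrite fa fb => h.
apply: (le_trans h); apply: (le_trans fl).
apply: (le_trans (leeD (ltW l1) (ltW l2))).
by rewrite addeACA -EFinD -splitr.
Qed.

End intrinsic_distance.

(** * Coordinates and convexity of the chart *)

Section coordinates.
Context (R : realType) (k : nat).
Implicit Types (p q : 'rV[R]_(2 + k)) (z : 'rV[R]_k).

Lemma xcoordE p : xcoord p = p 0 (lshift k 0).
Proof. by rewrite /xcoord mxE. Qed.

Lemma ycoordE p : ycoord p = p 0 (lshift k 1).
Proof. by rewrite /ycoord mxE. Qed.

Lemma zcoordE p i : zcoord p 0 i = p 0 (rshift 2 i).
Proof. by rewrite /zcoord mxE. Qed.

Lemma xcoord_pt (x y : R) z : xcoord (pt x y z) = x.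
Proof. by rewrite /xcoord /pt row_mxKl mxE. Qed.

Lemma ycoord_pt (x y : R) z : ycoord (pt x y z) = y.
Proof. by rewrite /ycoord /pt row_mxKl mxE. Qed.

Lemma zcoord_pt (x y : R) z : zcoord (pt x y z) = z.
Proof. by rewrite /zcoord /pt row_mxKr. Qed.

Lemma coord_lin (a b : R) p q :
  [/\ xcoord (a *: p + b *: q) = a * xcoord p + b * xcoord q,
     ycoord (a *: p + b *: q) = a * ycoord p + b * ycoord q &
     zcoord (a *: p + b *: q) = a *: zcoord p + b *: zcoord q].
Proof.
by rewrite !xcoordE !ycoordE !mxE; split => //; apply/rowP => i; rewrite !(mxE, zcoordE).
Qed.

Lemma coordB p q :
  [/\ xcoord (p - q) = xcoord p - xcoord q, ycoord (p - q) = ycoord p - ycoord q &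
     zcoord (p - q) = zcoord p - zcoord q].
Proof.
by rewrite !xcoordE !ycoordE !mxE; split => //; apply/rowP => i; rewrite !(mxE, zcoordE).
Qed.

Lemma segment_coords p q (t : R) : let r := p + t *: (q - p) in
  xcoord r = xcoord p + t * (xcoord q - xcoord p) /\
  ycoord r = ycoord p + t * (ycoord q - ycoord p).
Proof. by rewrite /= !xcoordE !ycoordE !mxE. Qed.

Lemma sqr_enorm_coord p :
  enorm p ^+ 2 = xcoord p ^+ 2 + ycoord p ^+ 2 + enorm (zcoord p) ^+ 2.
Proof.
rewrite !sqr_enorm big_split_ord/= !big_ord_recl big_ord0 addr0 xcoordE ycoordE.
congr (_ + _ ^+ 2 + _); first by congr (p 0 _); apply: val_inj.
by apply: eq_bigr => i _; rewrite zcoordE.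
Qed.

Lemma pt_affine (r : R) z : pt r r z = pt 0 0 z + r *: pt 1 1 0.
Proof.
rewrite /pt scale_row_mx add_row_mx scaler0 addr0; congr row_mx.
by apply/rowP => i; rewrite !mxE; case: ifP => _; rewrite mulr1 add0r.
Qed.

End coordinates.

Section enorm_bound.
Context (R : realType) (n : nat).

(** The factor n + 1 is crude but positive even for n = 0, so it can later stand in a
    denominator. *)
Lemma enorm_le_coord (v : 'rV[R]_n) (r : R) : 0 <= r -> (forall i, `|v 0 i| <= r) ->
  enorm v <= n.+1%:R * r.
Proof.
move=> r0 vr; rewrite -(@ler_pXn2r _ 2)// ?nnegrE ?enorm_ge0 ?mulr_ge0//.
rewrite sqr_enorm exprMn; apply: (@le_trans _ _ (\sum_(i < n) r ^+ 2)).
  by apply: ler_sum => i _; rewrite -real_normK ?num_real// ler_pXn2r ?nnegrE.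
rewrite sumr_const card_ord -[leLHS]mulr_natl; apply: ler_wpM2r; first exact: sqr_ge0.
by rewrite -natrX ler_nat (leq_trans (leqnSn n))// -{1}[n.+1]expn1 leq_pexp2l.
Qed.

Lemma eball_convex (c : 'rV[R]_n) (r t : R) v w : 0 <= t <= 1 ->
  eball c r v -> eball c r w -> eball c r ((1 - t) *: v + t *: w).
Proof.
rewrite /eball/= => t01 vr wr; have r0 := le_lt_trans (enorm_ge0 _) vr.
have -> : (1 - t) *: v + t *: w - c = (1 - t) *: (v - c) + t *: (w - c).
  rewrite !scalerBr addrACA -opprD -scalerDl.
  by rewrite (_ : 1 - t + t = 1) ?scale1r// subrK.
rewrite -(@ltr_pXn2r _ 2)// ?nnegrE ?enorm_ge0 ?(ltW r0)//.
apply: le_lt_trans (enorm_convex _ _ t01) _.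
have v2 : enorm (v - c) ^+ 2 < r ^+ 2 by rewrite ltr_pXn2r ?nnegrE ?enorm_ge0 ?(ltW r0).
have w2 : enorm (w - c) ^+ 2 < r ^+ 2 by rewrite ltr_pXn2r ?nnegrE ?enorm_ge0 ?(ltW r0).
case/andP: t01 => t0 t1.
have [->|t0'] := eqVneq t 0; first by rewrite subr0 mul1r mul0r addr0.
have t_gt0 : 0 < t by rewrite lt_neqAle eq_sym t0'.
have h1 : 0 <= (1 - t) * (r ^+ 2 - enorm (v - c) ^+ 2) by rewrite mulr_ge0//; lra.
have h2 : 0 < t * (r ^+ 2 - enorm (w - c) ^+ 2) by rewrite mulr_gt0//; lra.
by lra.
Qed.

(** Convexity makes straight segments admissible for the intrinsic distance. *)
Lemma open_chart_convex (eps r t : R) (c : 'rV[R]_n) p q : 0 <= t <= 1 ->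
  open_chart eps (eball c r) p -> open_chart eps (eball c r) q ->
  open_chart eps (eball c r) ((1 - t) *: p + t *: q).
Proof.
move=> t01 [/andP[px0 px1] /andP[py0 py1] pz] [/andP[qx0 qx1] /andP[qy0 qy1] qz].
have [xE yE zE] := coord_lin (1 - t) t p q.
have mid (l x y u : R) : l < x -> x < u -> l < y -> y < u -> l < (1 - t) * x + t * y < u.
  case/andP: t01 => t0 t1 lx xu ly yu.
  by have [xy|yx] := leP x y; apply/andP; split; nra.
by split; rewrite ?xE ?yE ?zE; [exact: mid|exact: mid|exact: eball_convex].
Qed.

End enorm_bound.

(** * Lengths of segments near the corner *)

Section segments.
Context (R : realType) (k : nat) (mu : {finite_measure set (R * R)%type -> \bar R}).
Variables (u : R * R -> 'rV[R]_(2 + k) -> R) (g0 : 'rV[R]_(2 + k) -> 'M[R]_(2 + k)).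
Variables (c0 C0 cu Cu : R) (eps rho : R) (c : 'rV[R]_k).
Notation lambda := (@lebesgue_measure R).
Local Notation X := (open_chart eps (eball c rho)).
Hypothesis hE : forall a, msupp mu a -> [/\ 0 <= a.1, 0 <= a.2 & a.1 + a.2 <= 2].
Hypotheses (hc0 : 0 < c0) (hC0 : c0 <= C0) (hcu : 0 < cu) (hCu : cu <= Cu).
Hypothesis eps1 : eps < 1.
Hypothesis hg0 : forall p v, X p ->
  c0 * enorm v ^+ 2 <= metric_sq g0 p v <= C0 * enorm v ^+ 2.
Hypothesis hu0 : forall a p, msupp mu a -> X p -> 0 < u a p.
Hypothesis huae : {ae mu, forall a, msupp mu a -> forall p, X p -> cu <= u a p <= Cu}.
Let g := gmu mu u g0.
Let w (n : nat) : R := Num.sqrt (Tmu mu n%:R).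
Let w0 n : 0 <= w n. Proof. exact: sqrtr_ge0. Qed.
Let K := Num.sqrt (C0 * Cu).
Let K0 : 0 < K.
Proof.
rewrite sqrtr_gt0; apply: mulr_gt0; [exact: lt_le_trans hC0|exact: lt_le_trans hCu].
Qed.
Let d := intrinsic_dist g X.

Lemma open_chart_coords p : X p -> 0 < xcoord p < 1 /\ 0 < ycoord p < 1.
Proof.
by move=> [/andP[-> h1] /andP[-> h2] _]; rewrite (lt_trans h1)// (lt_trans h2).
Qed.

Let speed_leX p v n m : X p -> m <= xcoord p -> m <= ycoord p ->
  expR (- n.+1%:R) <= m <= expR (- n%:R) ->
  Num.sqrt (metric_sq g p v) <= K * (expR n.+1%:R * w n) * enorm v.
Proof. exact: (speed_le hE hc0 hC0 hcu hCu open_chart_coords hg0 hu0 huae v). Qed.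

Lemma ac_segment p q : X p -> X q -> ac_curve_in X `[0, 1] (fun t => p + t *: (q - p)).
Proof.
move=> Xp Xq; split => [t|a b _ _ _]; last exact: abs_continuous_affine.
rewrite in_itv/= => t01.
rewrite (_ : p + _ = (1 - t) *: p + t *: q); first exact: open_chart_convex.
by rewrite scalerBr scalerBl scale1r addrCA addrC.
Qed.

Lemma segment_dist_le_length p q : X p -> X q ->
  (d p q <= curve_length g `[0%R, 1%R] (fun t => (p + t *: (q - p))%R))%E.
Proof.
move=> Xp Xq; have := intrinsic_dist_le_length g ler01 (ac_segment Xp Xq).
by rewrite scale0r addr0 scale1r subrKC.
Qed.

(** The affine function from m0 to m1 stays below both coordinates along the segment, and by the
    last hypothesis its slope is at least half the Euclidean speed, whence the 2 in the bound. *)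
Lemma segment_dist p q (m0 m1 : R) (N : nat) : X p -> X q ->
  m0 <= xcoord p -> m0 <= ycoord p -> m1 <= xcoord q -> m1 <= ycoord q ->
  0 < m0 <= expR (- N%:R) -> 0 < m1 <= expR (- N%:R) -> m0 != m1 ->
  enorm (q - p) <= 2 * `|m1 - m0| ->
  (d p q <= (2 * K * expR 1)%:E * \sum_(N <= n <oo) (w n)%:E)%E.
Proof.
move=> Xp Xq xp yp xq yq /andP[m00 m0N] /andP[m10 m1N] m01 pq.
apply: (le_trans (segment_dist_le_length Xp Xq)).
have mid t (x y : R) : 0 <= t <= 1 -> x <= expR (- N%:R) -> y <= expR (- N%:R) ->
    0 < x -> 0 < y -> 0 < (y - x) * t + x <= expR (- N%:R).
  move=> /andP[t0 t1] xN yN x0 y0; apply/andP; split.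
    by have [xy|yx] := leP x y; nra.
  by have [xy|yx] := leP x y; nra.
have low t (x y x' y' : R) : 0 <= t <= 1 -> x <= x' -> y <= y' ->
    (y - x) * t + x <= x' + t * (y' - x').
  by move=> /andP[t0 t1] xx' yy'; nra.
apply: (@dyadic_upper_bound R _ (m1 - m0) m0) => //.
- by rewrite subr_eq0 eq_sym.
- by rewrite mulr_gt0.
- by move=> t; rewrite /= in_itv/= => t01; apply: mid.
move=> t n; rewrite /= in_itv/= => t01 hn; rewrite derive1_affine lee_fin.
have Xt : X (p + t *: (q - p)) by apply: (ac_segment Xp Xq).1; rewrite in_itv.
have [xt yt] := segment_coords p q t.
apply: (le_trans (speed_leX (q - p) Xt _ _ hn)).
- by rewrite xt; exact: low.
- by rewrite yt; exact: low.
rewrite (_ : 2 * K * _ * _ = K * (expR n.+1%:R * w n) * (2 * `|m1 - m0|)).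
  by rewrite ler_wpM2l// mulr_ge0 ?(ltW K0)// mulr_ge0// expR_ge0.
ring.
Qed.

(** The large factor e^(N+1) is harmless: |q - p| is made small after [N] is fixed. *)
Lemma segment_dist_level p q (N : nat) : X p -> X q ->
  expR (- N%:R) <= xcoord p -> expR (- N%:R) <= ycoord p ->
  expR (- N%:R) <= xcoord q -> expR (- N%:R) <= ycoord q ->
  (d p q <= (K * (expR N.+1%:R * w N) * enorm (q - p))%:E)%E.
Proof.
move=> Xp Xq xp yp xq yq; apply: (le_trans (segment_dist_le_length Xp Xq)).
set M := K * _ * _; have M0 : 0 <= M.
  by rewrite !mulr_ge0 ?(ltW K0) ?expR_ge0 ?enorm_ge0.
pose J : set (measurableTypeR R) := `[0, 1]%classic.
have mJ : measurable J by exact: measurable_itv.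
have lJ : lambda J = 1%E by rewrite /J lebesgue_measure_itv/= lte_fin ltr01 oppr0 adde0.
apply: (@le_trans _ _ (\int[lambda]_(t in J) (cst M%:E) t)%E); last first.
  by rewrite integral_cst// [X in (_ * X <= _)%E]lJ mule1.
apply: (@integral_ge0_mono _ _ R lambda J J) => [t _|t _|t t01 _].
- by rewrite lee_fin sqrtr_ge0.
- by rewrite lee_fin.
split=> //; rewrite derive1_affine lee_fin.
have Xt : X (p + t *: (q - p)) by apply: (ac_segment Xp Xq).1.
have [xt yt] := segment_coords p q t.
move: t01; rewrite /J/= in_itv/= => /andP[t0 t1].
apply: (speed_leX (m := expR (- N%:R)) (q - p) Xt).
- by rewrite xt; nra.
- by rewrite yt; nra.
- by rewrite lexx andbT expRN_le.
Qed.

Lemma diagonal_length (z : 'rV[R]_k) (delta : R) : eball c rho z -> 0 < delta < eps ->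
  (curve_length g `]0%R, delta] (fun r => pt r r z) <=
   ((K * (enorm (pt 1 1 (0 : 'rV[R]_k)) + 1)) * expR 1)%:E * \sum_(0 <= n <oo) (w n)%:E)%E.
Proof.
move=> Bz /andP[d0 de].
have -> : (fun r => pt r r z) = (fun r => pt 0 0 z + r *: pt 1 1 0).
  by apply/funext => r; exact: pt_affine.
have v0 := enorm_ge0 (pt 1 1 (0 : 'rV[R]_k)).
(* The minorant is r itself, and slices start at N = 0 since delta < eps < 1. The 1 added to the
   norm makes positivity of the constant immediate. *)
apply: (@dyadic_upper_bound R _ 1 0) => //.
- by rewrite mulr_gt0//; lra.
- move=> t; rewrite /= in_itv/= mul1r addr0 oppr0 expR0 => /andP[-> td]/=.
  exact: le_trans td (ltW (lt_trans de eps1)).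
move=> t n; rewrite /= in_itv/= mul1r addr0 => /andP[t0 td] hn.
rewrite derive1_affine lee_fin -pt_affine.
have Xt : X (pt t t z).
  by split; rewrite ?xcoord_pt ?ycoord_pt ?zcoord_pt//; rewrite t0 (le_lt_trans td de).
apply: (le_trans (speed_leX (pt 1 1 0) Xt _ _ hn)); rewrite ?xcoord_pt ?ycoord_pt//.
rewrite normr1 mulr1 mulrAC ler_wpM2r//.
  by rewrite mulr_ge0 ?expR_ge0.
by rewrite ler_wpM2l ?(ltW K0)//; lra.
Qed.

(** Motion in z takes place only at level M = e^-N, away from the faces; on the outer segments z is
    constant, which keeps their Euclidean length comparable with M - m. *)
Lemma dist_near_corner_le p q (N : nat) : X p -> X q -> expR (- N%:R) < eps ->
  xcoord p < expR (- N%:R) -> ycoord p < expR (- N%:R) ->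
  xcoord q < expR (- N%:R) -> ycoord q < expR (- N%:R) ->
  (d p q <= (2 * K * expR 1)%:E * (\sum_(N <= n <oo) (w n)%:E) +
    (K * (expR N.+1%:R * w N) * enorm (zcoord q - zcoord p))%:E +
    (2 * K * expR 1)%:E * (\sum_(N <= n <oo) (w n)%:E))%E.
Proof.
move=> Xp Xq Me; set M := expR _ in Me *; have M0 : 0 < M by exact: expR_gt0.
pose top (r : 'rV[R]_(2 + k)) := pt M M (zcoord r).
have Xtop r : X r -> X (top r).
  by move=> [_ _ Bz]; split; rewrite ?xcoord_pt ?ycoord_pt ?zcoord_pt// M0.
have base r : X r -> xcoord r < M -> ycoord r < M ->
    let m := Num.min (xcoord r) (ycoord r) in
    [/\ m <= xcoord r, m <= ycoord r, 0 < m < M & enorm (top r - r) <= 2 * (M - m)].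
  move=> Xr xM yM m; have [/andP[x0 _] /andP[y0 _]] := open_chart_coords Xr.
  have mx : m <= xcoord r by rewrite ge_min lexx.
  have my : m <= ycoord r by rewrite ge_min lexx orbT.
  have m0 : 0 < m by rewrite lt_min x0.
  split => //; first by rewrite m0 (le_lt_trans mx).
  (* Both coordinates of [r] lie in [m, M[, so the squared norm is at most 2 (M - m)^2. *)
  rewrite -(@ler_pXn2r _ 2)// ?nnegrE ?enorm_ge0 ?mulr_ge0//; try lra.
  rewrite sqr_enorm_coord; have [-> -> ->] := coordB (top r) r.
  rewrite xcoord_pt ycoord_pt zcoord_pt subrr enorm0; nra.
move=> xp yp xq yq.
have [mxp myp /andP[mp0 mpM] ep] := base p Xp xp yp.
have [mxq myq /andP[mq0 mqM] eq] := base q Xq xq yq.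
set mp := Num.min _ _ in mxp myp mp0 mpM ep.
set mq := Num.min _ _ in mxq myq mq0 mqM eq.
apply: (le_trans (intrinsic_dist_triangle _ _ _ (top q) _)); apply: leeD.
  apply: (le_trans (intrinsic_dist_triangle _ _ _ (top p) _)); apply: leeD.
    apply: (@segment_dist p (top p) mp M) => //; rewrite ?xcoord_pt ?ycoord_pt//.
    - exact: Xtop.
    - by rewrite mp0 ltW.
    - by rewrite M0 lexx.
    - by rewrite lt_eqF.
    - by rewrite gtr0_norm ?subr_gt0.
  have -> : enorm (zcoord q - zcoord p) = enorm (top q - top p).
    apply/eqP; rewrite -(@eqrXn2 _ 2) ?enorm_ge0// [X in _ == X]sqr_enorm_coord.
    have [-> -> ->] := coordB (top q) (top p).
    by rewrite !xcoord_pt !ycoord_pt !zcoord_pt !subrr expr0n/= !add0r.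
  by apply: segment_dist_level; rewrite ?xcoord_pt ?ycoord_pt//; exact: Xtop.
apply: (@segment_dist (top q) q M mq) => //; rewrite ?xcoord_pt ?ycoord_pt//.
- exact: Xtop.
- by rewrite M0 lexx.
- by rewrite mq0 ltW.
- by rewrite gt_eqF.
- rewrite ltr0_norm ?subr_lt0// opprB (le_trans _ eq)//.
  by rewrite -[top q - q]opprB -[X in _ <= enorm X]scaleN1r enormZ normrN1 mul1r.
Qed.

End segments.

Lemma cvge0_lt (R : realType) (a : nat -> \bar R) : (forall i, (0 <= a i)%E) ->
  (forall e : R, 0 < e -> \forall i \near \oo, (a i < e%:E)%E) ->
  a i @[i --> \oo] --> 0%E.
Proof.
move=> a0 ae; apply/fine_cvgP; split.
  by apply: filterS (ae 1 ltr01) => i ai; rewrite ge0_fin_numE// (lt_trans ai) ?ltry.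
apply/cvgrPdist_lt => e e0; apply: filterS (ae e e0) => i ai /=.
have fi : a i \is a fin_num by rewrite ge0_fin_numE// (lt_trans ai) ?ltry.
by rewrite sub0r normrN ger0_norm ?fine_ge0// -lte_fin fineK.
Qed.

Lemma expRN_small (R : realType) (e : R) : 0 < e -> exists N : nat, expR (- N%:R) < e.
Proof.
move=> e0; exists (Num.truncn `|ln e|).+1.
rewrite -[ltRHS]lnK ?posrE// ltr_expR ltrNl.
by apply: le_lt_trans (truncnS_gt _); rewrite -normrN ler_norm.
Qed.

(** Compactness bounds the set of sums; on an unbounded set [sup] would be a default value. *)
Lemma msupp_sum_le (R : realType) (mu : {measure set (R * R)%type -> \bar R}) a :
  compact (msupp mu) -> msupp mu a -> a.1 + a.2 <= Amu mu.
Proof.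
move=> cE Ea; apply: ub_le_sup; last by exists a.
have [M [_ HM]] := compact_bounded cE.
exists ((M + 1) + (M + 1)) => _ [b Eb <-].
have bM : `|b| <= M + 1 by apply: HM => //; lra.
have b1 : `|b.1| <= M + 1 by apply: le_trans bM; rewrite prod_normE le_max lexx.
have b2 : `|b.2| <= M + 1 by apply: le_trans bM; rewrite prod_normE le_max lexx orbT.
by have := ler_norm b.1; have := ler_norm b.2; lra.
Qed.

(** * Each condition against the dyadic series *)

Section equivalences.
Context (R : realType) (k : nat) (mu : {finite_measure set (R * R)%type -> \bar R}).
Variables (u : R * R -> 'rV[R]_(2 + k) -> R) (g0 : 'rV[R]_(2 + k) -> 'M[R]_(2 + k)).
Variables (c0 C0 cu Cu : R) (eps rho : R) (c : 'rV[R]_k).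
Notation lambda := (@lebesgue_measure R).
Local Notation B := (eball c rho).
Local Notation X := (open_chart eps B).
Hypothesis hE : forall a, msupp mu a -> [/\ 0 <= a.1, 0 <= a.2 & a.1 + a.2 <= 2].
Hypotheses (hc0 : 0 < c0) (hC0 : c0 <= C0) (hcu : 0 < cu) (hCu : cu <= Cu).
Hypothesis (eps0 : 0 < eps) (eps1 : eps < 1).
Hypothesis hg0 : forall p v, X p ->
  c0 * enorm v ^+ 2 <= metric_sq g0 p v <= C0 * enorm v ^+ 2.
Hypothesis hu0 : forall a p, msupp mu a -> X p -> 0 < u a p.
Hypothesis huae : {ae mu, forall a, msupp mu a -> forall p, X p -> cu <= u a p <= Cu}.
Let g := gmu mu u g0.
Let d := intrinsic_dist g X.
Let w (n : nat) : R := Num.sqrt (Tmu mu n%:R).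
Let w0 n : 0 <= w n. Proof. exact: sqrtr_ge0. Qed.
Let series_fin := (\sum_(n <oo) (w n)%:E < +oo)%E.

Let K1 : R := 2 / Num.sqrt (c0 * cu) / (1 - expR (- 1)).

Let e1 : 0 < 1 - expR (- 1) :> R.
Proof. by rewrite subr_gt0 -[ltRHS]expR0 ltr_expR oppr_lt0. Qed.

Lemma partial_series_le (a b : R) (gamma : R -> 'rV[R]_(2 + k)) (N K : nat) (L : \bar R)
    (s := fun t => xcoord (gamma t) + ycoord (gamma t)) :
  a <= b -> ac_curve_in X `[a, b] gamma -> (N <= K)%N ->
  (expR (- N%:R) <= s a /\ s b <= expR (- K%:R)) \/
  (s a <= expR (- K%:R) /\ expR (- N%:R) <= s b) ->
  (curve_length g `[a, b] gamma <= L)%E -> L \is a fin_num ->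
  \sum_(N <= n < K) w n.+1 <= K1 * fine L.
Proof.
move=> ab acg NK hs hL Lfin.
have k0 : 0 < 2 / Num.sqrt (c0 * cu) by rewrite divr_gt0// sqrtr_gt0 mulr_gt0.
have := curve_length_lower_bound hE hc0 hcu (@open_chart_coords _ _ _ _ _ eps1) hg0 hu0 huae
  ab acg NK hs.
rewrite -mulr_sumr => H.
have {}H := le_trans H (lee_wpmul2l (ltW k0 : (0 <= (2 / Num.sqrt (c0 * cu))%:E)%E) hL).
rewrite -(fineK Lfin) -EFinM lee_fin in H.
by rewrite /K1 -[leRHS]mulrA [_^-1 * _]mulrC mulrA ler_pdivlMr// mulrC.
Qed.

(** Compact subcurves from a fixed time to level e^-K cross slices N to K, and their lengths are
    bounded by that of the whole curve, uniformly in K. *)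
Lemma curve_to_corner_series (J : interval R) (gamma : R -> 'rV[R]_(2 + k)) :
  ac_curve_in X J gamma -> (curve_length g J gamma < +oo)%E ->
  (xcoord (gamma t) @[t --> upper_end J] --> (0 : R) /\
   ycoord (gamma t) @[t --> upper_end J] --> (0 : R)) \/
  (xcoord (gamma t) @[t --> lower_end J] --> (0 : R) /\
   ycoord (gamma t) @[t --> lower_end J] --> (0 : R)) -> series_fin.
Proof.
move=> [gX gac] Lfin hlim.
set L := curve_length _ _ _ in Lfin.
have L0 : (0 <= L)%E by exact: curve_length_ge0.
have {Lfin} Lfin : L \is a fin_num by rewrite ge0_fin_numE.
have sub a b : a \in J -> b \in J -> a <= b ->
    ac_curve_in X `[a, b] gamma /\ (curve_length g `[a, b] gamma <= L)%E.
  move=> aJ bJ ab.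
  have abJ t : t \in `[a, b] -> t \in J.
    rewrite in_itv/= => /andP[at' tb].
    by apply: (@interval_is_interval _ J a b) => //; rewrite at' tb.
  split; first by split => [t /abJ/gX//|x y /abJ xJ /abJ yJ]; exact: gac.
  apply: integral_ge0_mono => [t _|t _|t abt _].
  - by rewrite lee_fin sqrtr_ge0.
  - by rewrite lee_fin sqrtr_ge0.
  - by split => //; exact: abJ.
pose s t := xcoord (gamma t) + ycoord (gamma t).
have s_gt0 t : t \in J -> 0 < s t.
  by move=> /gX [/andP[x0 _] /andP[y0 _] _]; rewrite addr_gt0.
have close (end_ : interval R -> set_system R) (le' : rel R) :
    end_ J = filter_from [set` J] (fun t => [set s | s \in J /\ le' t s]) ->
    xcoord (gamma t) @[t --> end_ J] --> (0 : R) ->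
    ycoord (gamma t) @[t --> end_ J] --> (0 : R) ->
    forall e, 0 < e -> exists t1 t2, [/\ t1 \in J, t2 \in J &
      forall t, t \in J -> le' t1 t -> le' t2 t -> s t <= e].
  move=> endE hx hy e e0; have e20 : 0 < e / 2 by rewrite divr_gt0.
  have := hx _ (nbhsx_ballx (0 : R) _ e20); have := hy _ (nbhsx_ballx (0 : R) _ e20).
  rewrite /nbhs/= endE => -[t2 t2J h2] [t1 t1J h1]; exists t1, t2; split => // t tJ l1 l2.
  have := h1 t (conj tJ l1); have := h2 t (conj tJ l2).
  rewrite /= -ball_normE/= !sub0r !normrN => yt xt.
  have := ler_norm (xcoord (gamma t)); have := ler_norm (ycoord (gamma t)).
  by rewrite /s; lra.
case: hlim => -[hx hy].
- have cl := close _ <=%R erefl hx hy.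
  (* Only a point of [J] is wanted: an empty [J] has no end neighbourhoods at all, so the limits
     exclude it. *)
  have [t0 [_ [t0J _ _]]] := cl 1 ltr01.
  have [N hN] := expRN_small (s_gt0 _ t0J).
  apply: (@series_fin_partial _ _ N (K1 * fine L)) => K NK.
  have [t1 [t2 [t1J t2J ht]]] := cl _ (expR_gt0 (- K%:R)).
  pose T := Num.max t0 (Num.max t1 t2).
  have TJ : T \in J by rewrite /T /Num.max; repeat case: ifPn.
  have t0T : t0 <= T by rewrite le_max lexx.
  have [acT lT] := sub _ _ t0J TJ t0T.
  apply: (partial_series_le t0T acT NK _ lT Lfin); left; split; first exact: ltW.
  by apply: ht => //; rewrite !le_max lexx ?orbT.
- have cl := close _ >=%R erefl hx hy.
  have [t0 [_ [t0J _ _]]] := cl 1 ltr01.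
  have [N hN] := expRN_small (s_gt0 _ t0J).
  apply: (@series_fin_partial _ _ N (K1 * fine L)) => K NK.
  have [t1 [t2 [t1J t2J ht]]] := cl _ (expR_gt0 (- K%:R)).
  pose T := Num.min t0 (Num.min t1 t2).
  have TJ : T \in J by rewrite /T /Num.min; repeat case: ifPn.
  have t0T : T <= t0 by rewrite ge_min lexx.
  have [acT lT] := sub _ _ TJ t0J t0T.
  apply: (partial_series_le t0T acT NK _ lT Lfin); right; split; last exact: ltW.
  by apply: ht => //; rewrite /= !ge_min lexx ?orbT.
Qed.

Variable z0 : 'rV[R]_k.
Hypothesis Bz0 : B z0.
Local Notation o := (pt 0 0 z0).

Let diag (i : nat) : 'rV[R]_(2 + k) := pt (eps / 2 * harmonic i) (eps / 2 * harmonic i) z0.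

Let harm_gt0 i : 0 < eps / 2 * harmonic i.
Proof. by rewrite mulr_gt0 ?divr_gt0// /harmonic/= invr_gt0. Qed.

Let diagX i : X (diag i).
Proof.
have h : 0 < eps / 2 * harmonic i < eps.
  have e2 : eps / 2 < eps by have := eps0; lra.
  rewrite harm_gt0/=; apply: le_lt_trans e2.
  rewrite ler_piMr// ?divr_ge0 ?(ltW eps0)//.
  by rewrite /harmonic/= invf_le1 ?ltr0n// ler1n.
by split; rewrite ?xcoord_pt ?ycoord_pt ?zcoord_pt.
Qed.

Let diag_cvg0 : eps / 2 * harmonic i @[i --> \oo] --> 0.
Proof. by rewrite -(mulr0 (eps / 2)); apply: cvgMr; exact: cvg_harmonic. Qed.

Let diag_cvg : diag i @[i --> \oo] --> o.
Proof.
have H : o + (eps / 2 * harmonic i) *: pt 1 1 0 @[i --> \oo] --> o + 0 *: pt 1 1 0.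
  by apply: cvgD; [exact: cvg_cst|apply: cvgZr_tmp; exact: diag_cvg0].
have -> : diag = (fun i => o + (eps / 2 * harmonic i) *: pt 1 1 0).
  by apply/funext => i; rewrite /diag pt_affine.
by move: H; rewrite scale0r addr0.
Qed.

(** One sequence and one tolerance suffice: a fixed term of [diag] is joined to terms arbitrarily
    near the corner by curves of length below 1, which cross more and more slices. *)
Lemma cauchy_at_corner_series :
  (forall s : nat -> 'rV[R]_(2 + k), (forall i, X (s i)) -> s i @[i --> \oo] --> o ->
     cauchy_seq X d s) -> series_fin.
Proof.
move=> H; have [_ /(_ 1 ltr01)[N0 hN0]] := H diag diagX diag_cvg.
have sE i : xcoord (diag i) + ycoord (diag i) = eps * harmonic i.
  by rewrite xcoord_pt ycoord_pt -mulrDl -splitr.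
have s0 : 0 < xcoord (diag N0) + ycoord (diag N0).
  by rewrite sE mulr_gt0// /harmonic/= invr_gt0.
have [N hN] := expRN_small s0.
apply: (@series_fin_partial _ _ N (K1 * fine (1 : \bar R))) => K NK.
have [j hj sj] : exists2 j, (N0 <= j)%N & xcoord (diag j) + ycoord (diag j) <= expR (- K%:R).
  have e20 : 0 < expR (- K%:R) / 2 :> R by rewrite divr_gt0 ?expR_gt0.
  have /cvgrPdist_lt/(_ _ e20) [m _ hm] := diag_cvg0.
  exists (maxn N0 m); first exact: leq_maxl.
  have : `|0 - eps / 2 * harmonic (maxn N0 m)| < expR (- K%:R) / 2.
    exact: hm (maxn N0 m) (leq_maxr _ _).
  rewrite sub0r normrN (gtr0_norm (harm_gt0 _)) => h.
  by rewrite xcoord_pt ycoord_pt; lra.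
have [_ [a [b [gamma [ab acg ga gb ->]]]] lt1] := ereal_inf_lt (hN0 N0 j (leqnn _) hj).
apply: (partial_series_le ab acg NK _ (ltW lt1)) => //.
by rewrite /= ga gb; left; split => //; exact: ltW.
Qed.

(** Makes (b) a case of (a), at the lower end of the interval. *)
Lemma diagonal_to_corner (delta : R) : 0 < delta < eps ->
  let gamma := fun r => pt r r z0 in let J := `]0, delta] in
  [/\ ac_curve_in X J gamma,
     xcoord (gamma t) @[t --> lower_end J] --> (0 : R) &
     ycoord (gamma t) @[t --> lower_end J] --> (0 : R)].
Proof.
move=> /andP[d0 de] gamma J.
have gE : gamma = (fun r => o + r *: pt 1 1 0) by apply/funext => r; exact: pt_affine.
have lim0 : t @[t --> lower_end J] --> (0 : R).
  move=> S /nbhs_ballP[e /= e0 eS].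
  have m0 : 0 < Num.min delta (e / 2) by rewrite lt_min d0 divr_gt0.
  exists (Num.min delta (e / 2)).
    by rewrite /= in_itv/= m0 ge_min lexx.
  move=> t [/= + tm]; rewrite in_itv/= => /andP[t0 _]; apply: eS.
  have : t <= e / 2 by apply: le_trans tm _; rewrite ge_min lexx orbT.
  by rewrite -ball_normE/= sub0r normrN gtr0_norm//; lra.
split.
- split=> [t|a b _ _ _]; last by rewrite gE; exact: abs_continuous_affine.
  rewrite in_itv/= => /andP[t0 td].
  have t01 : 0 < t < eps by rewrite t0 (le_lt_trans td).
  by split; rewrite ?xcoord_pt ?ycoord_pt ?zcoord_pt.
- by under eq_fun do rewrite xcoord_pt; exact: lim0.
- by under eq_fun do rewrite ycoord_pt; exact: lim0.
Qed.

Lemma series_diagonal : series_fin ->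
  exists2 delta : R, 0 < delta < eps &
    (curve_length g `]0%R, delta] (fun r => pt r r z0) < +oo)%E.
Proof.
move=> hs; exists (eps / 2); first by have := eps0 => ?; apply/andP; split; lra.
have de : 0 < eps / 2 < eps by have := eps0 => ?; apply/andP; split; lra.
apply: le_lt_trans (diagonal_length hE hc0 hC0 hcu hCu eps1 hg0 hu0 huae Bz0 de) _.
by rewrite lte_mul_pinfty// lee_fin !mulr_ge0 ?addr_ge0 ?sqrtr_ge0 ?expR_ge0.
Qed.

Lemma series_near_corner : series_fin -> forall e : R, 0 < e ->
  exists2 r, 0 < r & forall p q, X p -> X q -> ball o r p -> ball o r q ->
    (d p q < e%:E)%E.
Proof.
move=> hs e e0; set K := Num.sqrt (C0 * Cu).
pose tau (N : nat) := (\sum_(N <= n <oo) (w n)%:E)%E.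
have K0 : 0 <= K by exact: sqrtr_ge0.
pose A := 2 * K * expR 1; have A0 : 0 <= A by rewrite !mulr_ge0// expR_ge0.
have tau_cvg : tau N @[N --> \oo] --> 0%E.
  apply: nneseries_tail_cvg => //.
  by move=> n _; rewrite lee_fin.
have eA : 0 < e / (4 * (A + 1)) by rewrite divr_gt0// mulr_gt0//; lra.
have /fine_cvgP[tfin /cvgrPdist_lt/(_ _ eA) tsmall] := tau_cvg.
have [N1 hN1] := expRN_small eps0.
have [N [Nfin Nsmall NN1]] : exists N, [/\ tau N \is a fin_num,
    fine (tau N) < e / (4 * (A + 1)) & (N1 <= N)%N].
  have [m _ hm] := filterI tfin tsmall.
  exists (maxn N1 m); have [h1 h2] := hm (maxn N1 m) (leq_maxr _ _).
  split => //; last exact: leq_maxl.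
  by move: h2; rewrite /= sub0r normrN; apply: le_lt_trans; exact: ler_norm.
have Meps : expR (- N%:R) < eps by apply: le_lt_trans hN1; exact: expRN_le.
pose Cz := K * (expR N.+1%:R * w N).
have Cz0 : 0 <= Cz by rewrite !mulr_ge0// expR_ge0.
(* The radius comes after [N], as [Cz] depends on [N]. Each of the three terms gets e / 4, so the
   sum stays strictly below e; 8 is 4 times the 2 in the bound 2 r for the entries of the
   z-displacement, and Cz + 1 cannot vanish. *)
pose r := Num.min (expR (- N%:R)) (e / (8 * (k.+1%:R * (Cz + 1)))).
have den0 : 0 < k.+1%:R * (Cz + 1) by rewrite mulr_gt0//; lra.
have r0 : 0 < r by rewrite lt_min expR_gt0 divr_gt0// mulr_gt0.
exists r => // p q Xp Xq op oq.
have coordo p' i : ball o r p' -> `|o 0 i - p' 0 i| < r.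
  by case=> _ h; have := h 0 i; rewrite -ball_normE.
have small p' : X p' -> ball o r p' -> xcoord p' < expR (- N%:R) /\ ycoord p' < expR (- N%:R).
  move=> Xp' bp'; have rN : r <= expR (- N%:R) by rewrite ge_min lexx.
  have := coordo p' (lshift k 0) bp'; have := coordo p' (lshift k 1) bp'.
  rewrite -!xcoordE -!ycoordE xcoord_pt ycoord_pt !sub0r !normrN => hy hx.
  by split; [have := ler_norm (xcoord p')|have := ler_norm (ycoord p')]; lra.
have [xp yp] := small p Xp op; have [xq yq] := small q Xq oq.
have := dist_near_corner_le hE hc0 hC0 hcu hCu eps1 hg0 hu0 huae Xp Xq Meps xp yp xq yq.
move=> /le_lt_trans; apply.
have zle : enorm (zcoord q - zcoord p) <= k.+1%:R * (2 * r).
  apply: enorm_le_coord; first by rewrite mulr_ge0// ltW.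
  move=> i; rewrite !mxE; have := coordo p (rshift 2 i) op; have := coordo q (rshift 2 i) oq.
  move=> hq hp.
  have := ler_distD (o 0 (rshift 2 i)) (q 0 (rshift 2 i)) (p 0 (rshift 2 i)).
  by rewrite [`|q _ _ - o _ _|]distrC; lra.
rewrite -/(tau N) -(fineK Nfin) -!EFinM -!EFinD lte_fin -/K -/A -/(w N) -/Cz.
have t1 : A * fine (tau N) <= e / 4.
  apply: (@le_trans _ _ ((A + 1) * (e / (4 * (A + 1))))).
    by apply: ler_pM => //; [rewrite fine_ge0//; apply: nneseries_ge0 => n _ _; rewrite lee_fin|lra|exact: ltW].
  by rewrite le_eqVlt; apply/orP; left; apply/eqP; field; rewrite gt_eqF//; lra.
have t2 : Cz * enorm (zcoord q - zcoord p) <= e / 4.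
  have rz : r <= e / (8 * (k.+1%:R * (Cz + 1))) by rewrite ge_min lexx orbT.
  apply: (@le_trans _ _ ((Cz + 1) * (k.+1%:R * (2 * (e / (8 * (k.+1%:R * (Cz + 1)))))))).
    apply: ler_pM => //; [exact: enorm_ge0|lra|].
    by apply: (le_trans zle); rewrite ler_wpM2l// ler_wpM2l.
  rewrite le_eqVlt; apply/orP; left; apply/eqP; field.
  by rewrite !gt_eqF//; lra.
lra.
Qed.

Lemma series_cauchy_at_corner : series_fin ->
  (forall s : nat -> 'rV[R]_(2 + k), (forall i, X (s i)) -> s i @[i --> \oo] --> o ->
     cauchy_seq X d s) /\
  (exists2 P, metric_completion X d P &
     forall s : nat -> 'rV[R]_(2 + k), (forall i, X (s i)) -> s i @[i --> \oo] --> o ->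
       completion_class X d s = P).
Proof.
move=> hs; have near := series_near_corner hs.
have ev (s : nat -> 'rV[R]_(2 + k)) r : s i @[i --> \oo] --> o -> 0 < r ->
    \forall i \near \oo, ball o r (s i).
  by move=> so r0; apply: so; exact: nbhsx_ballx.
have cau s : (forall i, X (s i)) -> s i @[i --> \oo] --> o -> cauchy_seq X d s.
  move=> sX so; split => // e e0; have [r r0 hr] := near e e0.
  have [N _ hN] := ev s r so r0; exists N => i j Ni Nj.
  by apply: hr => //; exact: hN.
split => //; exists (completion_class X d diag).
  by exists diag => //; exact: cau.
(* By symmetry inclusion is enough: [s] and [s'] both enter every ball at the corner, so their
   distance tends to 0. *)
have sub s s' : (forall i, X (s i)) -> s i @[i --> \oo] --> o ->
    (forall i, X (s' i)) -> s' i @[i --> \oo] --> o ->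
    completion_class X d s `<=` completion_class X d s'.
  move=> sX so s'X s'o t [ct st]; split => //.
  have s's : d (s' i) (s i) @[i --> \oo] --> 0%E.
    apply: cvge0_lt => [i|e e0]; first exact: intrinsic_dist_ge0.
    have [r r0 hr] := near e e0.
    by apply: filterS2 (ev s r so r0) (ev s' r s'o r0) => i h h'; exact: hr.
  have sum0 : (d (s' i) (s i) + d (s i) (t i))%E @[i --> \oo] --> 0%E.
    by rewrite -[X in _ --> X]adde0; apply: cvgeD.
  apply: (squeeze_cvge _ (cvg_cst 0%E) sum0).
  near=> i; rewrite intrinsic_dist_ge0/=; exact: intrinsic_dist_triangle.
move=> s sX so; apply/seteqP; split; apply: sub => //.
Unshelve. all: by end_near. Qed.

End equivalences.

Theorem corollary7p14 (R : realType) (k : nat) (V : set 'rV[R]_k) (eps : R)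
  (g0 : 'rV[R]_(2 + k) -> 'M[R]_(2 + k)) (c0 C0 : R)
  (mu : {finite_measure set (R * R)%type -> \bar R})
  (u : R * R -> 'rV[R]_(2 + k) -> R) (cu Cu : R)
  (c : 'rV[R]_k) (rho : R) (z0 : 'rV[R]_k) :
  let U := corner_chart eps V in
  let Uo := open_chart eps V in
  let E := msupp mu in
  let B := eball c rho in
  let UB := open_chart eps B in
  let g := gmu mu u g0 in
  let d := intrinsic_dist g UB in
  open V ->
  0 < eps < 1 ->
  riemannian_metric U g0 ->
  0 < c0 <= C0 ->
  (forall p v, U p ->
     c0 * enorm v ^+ 2 <= metric_sq g0 p v <= C0 * enorm v ^+ 2) ->
  radon mu ->
  (0 < mu setT)%E ->
  compact E ->
  (forall a, E a -> 0 <= a.1 /\ 0 <= a.2) ->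
  (forall a p, E a -> Uo p -> 0 < u a p) ->
  jointly_measurable E Uo u ->
  0 < cu <= Cu ->
  {ae mu, forall a, E a -> forall p, Uo p -> cu <= u a p <= Cu} ->
  {within Uo, continuous (Fmu mu u)} ->
  (forall p, Uo p -> 0 < Fmu mu u p) ->
  0 < rho ->
  relatively_compact_in B V ->
  Amu mu <= 2 ->
  B z0 ->
  [<->
    (exists (J : interval R) (gamma : R -> 'rV[R]_(2 + k)),
       [/\ ac_curve_in UB J gamma,
           (curve_length g J gamma < +oo)%E &
           (xcoord (gamma t) @[t --> upper_end J] --> (0 : R) /\
            ycoord (gamma t) @[t --> upper_end J] --> (0 : R)) \/
           (xcoord (gamma t) @[t --> lower_end J] --> (0 : R) /\
            ycoord (gamma t) @[t --> lower_end J] --> (0 : R))]);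
    (exists2 delta : R, 0 < delta < eps &
       (curve_length g `]0%R, delta] (fun r => pt r r z0) < +oo)%E);
    (exists2 S0 : R, 0 <= S0 &
       (\int[lebesgue_measure]_(S in `[S0, +oo[)
          (Num.sqrt (Tmu mu S))%:E < +oo)%E);
    ((forall s : nat -> 'rV[R]_(2 + k),
        (forall i, UB (s i)) -> s i @[i --> \oo] --> pt 0 0 z0 ->
        cauchy_seq UB d s) /\
     (exists2 P, metric_completion UB d P &
        forall s : nat -> 'rV[R]_(2 + k),
          (forall i, UB (s i)) -> s i @[i --> \oo] --> pt 0 0 z0 ->
          completion_class UB d s = P))].
Proof.
move=> U Uo E B UB g d _ /andP[eps0 eps1] _ /andP[c00 c0C0] hg0 _ _ cE E0 u0 _
  /andP[cu0 cuCu] uae _ _ _ [_ BV] A2 Bz0.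
have hE a : msupp mu a -> [/\ 0 <= a.1, 0 <= a.2 & a.1 + a.2 <= 2].
  move=> Ea; have [a1 a2] := E0 a Ea; split => //.
  exact: le_trans (msupp_sum_le cE Ea) A2.
have BsubV : B `<=` V := subset_trans (@subset_closure _ B) BV.
have UBUo p : UB p -> Uo p by move=> [hx hy /BsubV].
have UBU p : UB p -> U p.
  by move=> [/andP[x0 x1] /andP[y0 y1] /BsubV Vz]; split; rewrite ?x1 ?y1 ?ltW.
have hg0' p v : UB p -> c0 * enorm v ^+ 2 <= metric_sq g0 p v <= C0 * enorm v ^+ 2.
  by move=> /UBU; exact: hg0.
have hu0 a p : msupp mu a -> UB p -> 0 < u a p by move=> Ea /UBUo; exact: u0.
have huae : {ae mu, forall a, msupp mu a -> forall p, UB p -> cu <= u a p <= Cu}.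
  by apply: ae_imply uae => a H Ea p /UBUo; exact: H.
pose series_fin := (\sum_(n <oo) (Num.sqrt (Tmu mu n%:R))%:E < +oo)%E.
have aS := curve_to_corner_series hE c00 cu0 eps1 hg0' hu0 huae.
have dS := cauchy_at_corner_series hE c00 cu0 eps0 eps1 hg0' hu0 huae Bz0.
have Sb := series_diagonal hE c00 c0C0 cu0 cuCu eps0 eps1 hg0' hu0 huae Bz0.
have Sd := series_cauchy_at_corner hE c00 c0C0 cu0 cuCu eps0 eps1 hg0' hu0 huae Bz0.
(* The implications run round the cycle (a), (b), (c), (d), (a), each through the series; (b)
   reaches it because the diagonal is itself a curve to the corner, and (d) comes back to (a) by the
   diagonal. *)
tfae.
- by move=> [J [gamma [acg lg lim]]]; apply: Sb; exact: aS acg lg lim.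
- move=> [delta de ldelta].
  have [acg xlim ylim] := diagonal_to_corner Bz0 de.
  exists 0 => //; apply: series_integral_fin => //; apply: aS acg ldelta _.
  by right.
- by move=> [S0 S00 hS]; apply: Sd; exact: integral_series_fin S00 hS.
- move=> [cauchy _]; have [delta de ldelta] := Sb (dS cauchy).
  have [acg xlim ylim] := diagonal_to_corner Bz0 de.
  by exists `]0, delta], (fun r => pt r r z0); split => //; right.
Qed.
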